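(* Let $\mathcal D$ be any Kac-Moody root datum. Then the affinized length $\ell^a$ on $W^a_+$ defines a $\mathbb Z$-grading of $W^a_+$ strictly compatible with the affinized Bruhat order. Otherwise said (in addition to strict compatibility, i.e. $\mathbf x<\mathbf y$ if and only if $\mathbf x,\mathbf y$ are comparable and $\ell^a(\mathbf x)<\ell^a(\mathbf y)$): for all $\mathbf x,\mathbf y\in W^a_+$ such that $\mathbf x\leq \mathbf y$, $$\mathbf y \text{ covers } \mathbf x \iff \ell^a(\mathbf y)-\ell^a(\mathbf x)=1 .$$
   Context: Root datum. A Kac-Moody root datum $\mathcal D=(A,X,Y,(\alpha_i)_{i\in I},(\alpha_i^\vee)_{i\in I})$ consists of a finite set $I$, a generalized Cartan matrix $A=(a_{ij})_{i,j\in I}$, two free $\mathbb Z$-modules $X,Y$ of finite rank in duality via $\langle\cdot,\cdot\rangle$ (the two arguments are written in either order), and linearly independent families $(\alpha_i)$ in $X$ and $(\alpha_i^\vee)$ in $Y$ with $\langle\alpha_i^\vee,\alpha_j\rangle=a_{ij}$. The vectorial Weyl group $W\subset \mathrm{Aut}_{\mathbb Z}(X)$ is generated by $s_i:x\mapsto x-\langle\alpha_i^\vee,x\rangle\alpha_i$; it acts on $Y$ by $s_i(y)=y-\langle y,\alpha_i\rangle\alpha_i^\vee$, and the bracket is $W$-invariant. With $S=\{s_i\mid i\in I\}$, $(W,S)$ is a Coxeter system with length $\ell$ and Bruhat order $<$. Real roots: $\Phi=W\cdot\{\alpha_i\}$, $\Phi_+=\Phi\cap\bigoplus_i\mathbb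 N\alpha_i$, $\Phi_-=-\Phi_+$, $\Phi=\Phi_+\sqcup\Phi_-$. If $\beta=w(\alpha_i)$, then $\beta^\vee=w(\alpha_i^\vee)$ and $s_\beta=ws_iw^{-1}$. For $w\in W$, $\mathrm{Inv}(w)=\Phi_+\cap w^{-1}(\Phi_-)$. Coweights. $Y^{++}=\{\lambda\in Y\mid\langle\lambda,\alpha_i\rangle\ge0\ \forall i\in I\}$ (dominant coweights) and $Y^+=W\cdot Y^{++}$. For $\lambda\in Y^+$, $\lambda^{++}$ is the unique element of $Y^{++}$ in its $W$-orbit. Affinized Weyl semigroup. $W^a=Y\rtimes W$, with elements written $\pi^\lambda w$ ($\lambda\in Y$, $w\in W$), and $W^a_+=Y^+\rtimes W\subset W^a$ (a subsemigroup). Affinized roots: $\Phi^a=\Phi\times\mathbb Z$, $(\beta,n)$ written $\beta+n\pi$; it is positive (in $\Phi^a_+$) if $n>0$, or $n=0$ and $\beta\in\Phi_+$. $W^a$ acts on $\Phi^a$ by $\pi^\lambda w(\beta+n\pi)=w(\beta)+(n+\langle\lambda,w(\beta)\rangle)\pi$. Put $\mathrm{sgn}(n)=1$ if $n\ge0$ and $-1$ if $n<0$. For $\beta\in\Phi_+$, $n\in\mathbb Z$, $\beta[n]=\mathrm{sgn}(n)\beta+|n|\pi\in\Phi^a_+$; for $\beta\in\Phi_-$, $\beta[n]=(-\beta)[-n]$. In all cases $s_{\beta[n]}=\pi^{n\beta^\vee}s_\beta\in W^a$. Affinized Bruhat order. For $\mathbf x\in W^a_+$ and $\beta[n]\in\Phi^a_+$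 with $\mathbf xs_{\beta[n]}\in W^a_+$, set $\mathbf x<\mathbf xs_{\beta[n]}$ if and only if $\mathbf x(\beta[n])\in\Phi^a_+$; the affinized Bruhat order on $W^a_+$ is the order generated by these relations by transitivity (it is known to be a partial order). We say $\mathbf y$ covers $\mathbf x$ if $\mathbf x\ne\mathbf y$ and $\{\mathbf z\mid\mathbf x\le\mathbf z\le\mathbf y\}=\{\mathbf x,\mathbf y\}$. A $\mathbb Z$-grading is a strictly compatible length function for which $\mathbf y$ covers $\mathbf x$ if and only if $\mathbf x\le\mathbf y$ and the length of $\mathbf y$ is the length of $\mathbf x$ plus $1$. Height and length. Fix once and for all fundamental weights $(\Lambda_i)_{i\in I}$ in $X\otimes_{\mathbb Z}\mathbb Q$, i.e. $\langle\alpha_i^\vee,\Lambda_j\rangle=\delta_{ij}$; let $\rho=\sum_i\Lambda_i$ and $\mathrm{ht}(\lambda)=\langle\lambda,\rho\rangle$ for $\lambda\in Y$. The affinized length is $$\ell^a(\pi^\lambda w)=2\,\mathrm{ht}(\lambda^{++})+|\{\alpha\in\mathrm{Inv}(w^{-1})\mid\langle\lambda,\alpha\rangle\ge0\}|-|\{\alpha\in\mathrm{Inv}(w^{-1})\mid\langle\lambda,\alpha\rangle<0\}|.$$ *)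

(* Defs.v *)
From HB Require Import structures.
From Stdlib Require Import Relation_Operators.
From mathcomp Require Import all_boot all_order all_algebra finmap.
From mathcomp Require Import boolp classical_sets cardinality.

Set Implicit Arguments.
Unset Strict Implicit.
Unset Printing Implicit Defensive.

Import Order.TTheory GRing.Theory Num.Theory.
Import VectorInternalTheory.
Local Open Scope classical_set_scope.
Local Open Scope ring_scope.

(** ** The group Aut_Z(V) of a free Z-module V of finite rank

    [vectType int] is the library's structure of Z-modules linearly isomorphic
    to Z^n for some n. *)

Section AutGroup.
Variable V : vectType int.

(* An automorphism is stored together with its (unique) inverse, see [autP]. *)
Record aut := Aut {
  aut_pair : 'End(V) * 'End(V);
  aut_pairP : ((aut_pair.1 \o aut_pair.2)%VF == \1%VF)
              && ((aut_pair.2 \o aut_pair.1)%VF == \1%VF) }.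

HB.instance Definition _ := [isSub for aut_pair].
HB.instance Definition _ := [Choice of aut by <:].

Definition aut_lfun (f : aut) : 'End(V) := (val f).1.
Definition aut_fun (f : aut) : V -> V := aut_lfun f.
Coercion aut_fun : aut >-> Funclass.

Fact aut_oneP : ((\1 : 'End(V)) \o \1 == \1)%VF && ((\1 : 'End(V)) \o \1 == \1)%VF.
Proof. by rewrite comp_lfun1l eqxx. Qed.
Definition aut_one : aut := @Aut (\1%VF, \1%VF) aut_oneP.

Fact aut_invP (f : aut) :
  (((val f).2 \o (val f).1)%VF == \1%VF) && (((val f).1 \o (val f).2)%VF == \1%VF).
Proof. by rewrite andbC; exact: aut_pairP. Qed.
Definition aut_inv (f : aut) : aut := @Aut ((val f).2, (val f).1) (aut_invP f).

Fact aut_mulP (f g : aut) :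
  let h := (((val f).1 \o (val g).1)%VF, ((val g).2 \o (val f).2)%VF) in
  ((h.1 \o h.2)%VF == \1%VF) && ((h.2 \o h.1)%VF == \1%VF).
Proof.
case: f g => -[f f'] /= /andP[/eqP ff' /eqP f'f] [] [g g'] /= /andP[/eqP gg' /eqP g'g].
rewrite comp_lfunA -(comp_lfunA f) gg' comp_lfun1r ff' eqxx /=.
by rewrite comp_lfunA -(comp_lfunA g') f'f comp_lfun1r g'g.
Qed.
Definition aut_mul (f g : aut) : aut := @Aut (_, _) (aut_mulP f g).

Fact aut_mulA : associative aut_mul.
Proof. by move=> f g h; apply: val_inj; rewrite /= !comp_lfunA. Qed.
Fact aut_mul1 : left_id aut_one aut_mul.
Proof.
by move=> f; apply: val_inj; rewrite /= comp_lfun1l comp_lfun1r; case: (val f).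
Qed.
Fact aut_mul1r : right_id aut_one aut_mul.
Proof.
by move=> f; apply: val_inj; rewrite /= comp_lfun1l comp_lfun1r; case: (val f).
Qed.
Fact aut_mulV : left_inverse aut_one aut_inv aut_mul.
Proof.
by move=> [[f f'] fP]; apply: val_inj; case/andP: (fP) => /= _ /eqP ->.
Qed.
Fact aut_mulrV : right_inverse aut_one aut_inv aut_mul.
Proof.
by move=> [[f f'] fP]; apply: val_inj; case/andP: (fP) => /= /eqP -> _.
Qed.

HB.instance Definition _ :=
  isGroup.Build aut aut_mulA aut_mul1 aut_mul1r aut_mulV aut_mulrV.

Lemma aut_mulE (f g : aut) x : (f * g)%g x = f (g x).
Proof. exact: comp_lfunE. Qed.

Lemma aut_oneE x : (1%g : aut) x = x.
Proof. exact: id_lfunE. Qed.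

Lemma autP (f g : aut) : f =1 g -> f = g.
Proof.
case: f g => -[f f'] fP [] [g g'] gP fg; apply: val_inj => /=.
have e : f = g by apply/lfunP => x; exact: fg.
case/andP: (fP) => /= _ /eqP f'f; case/andP: (gP) => /= /eqP gg' _.
by rewrite -[f']comp_lfun1r -gg' comp_lfunA -e f'f comp_lfun1l.
Qed.

End AutGroup.

(** ** Kac-Moody root data *)

Definition generalized_cartan (I : finType) (A : I -> I -> int) : Prop :=
  [/\ forall i, A i i = 2,
      forall i j, i != j -> A i j <= 0 &
      forall i j, A i j = 0 <-> A j i = 0].

Definition Zindependent (I : finType) (V : vectType int) (v : I -> V) : Prop :=
  forall c : I -> int, \sum_i c i *: v i = 0 -> forall i, c i = 0.

(* The duality between Y and X is an isomorphism of Y with Hom_Z(X, Z). *)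
Record root_datum := RootDatum {
  idx : finType;
  cartan : idx -> idx -> int;
  wt : vectType int;
  cowt : vectType int;
  duality : {linear cowt -> 'Hom(wt, int^o)};
  duality_inv : 'Hom(wt, int^o) -> cowt;
  sroot : idx -> wt;
  scoroot : idx -> cowt;
  cartanP : generalized_cartan cartan;
  dualityK : cancel duality duality_inv;
  duality_invK : cancel duality_inv duality;
  sroot_indep : Zindependent sroot;
  scoroot_indep : Zindependent scoroot;
  cartanE : forall i j, duality (scoroot i) (sroot j) = cartan i j }.

Section RootDatum.
Variable D : root_datum.
Local Notation I := (idx D).
Local Notation X := (wt D).
Local Notation Y := (cowt D).

Definition bracket (y : Y) (x : X) : int := duality D y x.
Local Notation "<< y , x >>" := (bracket y x)
  (at level 0, y at level 99, x at level 99, format "<< y ,  x >>").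

Lemma bracketBr y u v : << y, u - v >> = << y, u >> - << y, v >>.
Proof. by rewrite /bracket linearB. Qed.

Lemma bracketZr y a u : << y, a *: u >> = a * << y, u >>.
Proof. by rewrite /bracket linearZ. Qed.

Lemma bracket_ii i : << scoroot i, sroot i >> = 2.
Proof. by rewrite /bracket cartanE; case: (cartanP D). Qed.

Definition refl_fun (i : I) (x : X) : X := x - << scoroot i, x >> *: sroot i.

Fact refl_fun_linear i : linear (refl_fun i).
Proof.
move=> a u v; rewrite /refl_fun /bracket linearP /= scalerBr scalerDl scalerA opprD.
by rewrite addrACA.
Qed.
HB.instance Definition _ i :=
  GRing.isLinear.Build int X X *:%R (refl_fun i) (refl_fun_linear i).

Fact reflP i : let s : 'End(X) := linfun (refl_fun i) in
  ((s \o s)%VF == \1%VF) && ((s \o s)%VF == \1%VF).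
Proof.
rewrite /= andbb; apply/eqP/lfunP => x; rewrite comp_lfunE !lfunE /=.
rewrite /refl_fun bracketBr bracketZr bracket_ii; set c := << _, _ >>.
by rewrite -addrA -opprD -scalerDl addrA mulr_natr mulr2n subrr scale0r subr0.
Qed.

Definition srefl (i : I) : aut X := @Aut X (_, _) (reflP i).

Lemma sreflE i x : srefl i x = x - << scoroot i, x >> *: sroot i.
Proof. by rewrite /aut_fun /aut_lfun /= lfunE. Qed.

Inductive weyl : set (aut X) :=
| weyl_srefl i : weyl (srefl i)
| weyl_one : weyl 1%g
| weyl_mul v w : weyl v -> weyl w -> weyl (v * w)%g
| weyl_inv w : weyl w -> weyl (w^-1)%g.

(* The contragredient action on Y; [bracket_invariant] characterizes it and
   [coact_srefl] is the usual formula on generators. *)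
Definition coact (w : aut X) (y : Y) : Y :=
  duality_inv (duality D y \o aut_lfun (w^-1)%g)%VF.

Lemma bracket_coact w y x : << coact w y, x >> = << y, (w^-1)%g x >>.
Proof. by rewrite /bracket /coact duality_invK comp_lfunE. Qed.

Lemma bracket_invariant w y x : << coact w y, w x >> = << y, x >>.
Proof. by rewrite bracket_coact -aut_mulE mulVg aut_oneE. Qed.

Lemma coact_srefl i y : coact (srefl i) y = y - << y, sroot i >> *: scoroot i.
Proof.
apply: (can_inj (@dualityK D)); apply/lfunP => x.
apply: etrans (bracket_coact _ y x) _; rewrite -[LHS]/(<< y, srefl i x >>) sreflE.
rewrite bracketBr bracketZr linearB linearZ /= add_lfunE opp_lfunE scale_lfunE.
by rewrite mulrC.
Qed.

(** ** Real roots *)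

Definition root : set X := [set b | exists w i, weyl w /\ b = w (sroot i)].

Definition pos_root : set X :=
  [set b | root b /\ exists c : I -> nat, b = \sum_i sroot i *+ c i].

Definition neg_root : set X := [set b | pos_root (- b)].

(* For a root b, the coroot and the reflection below do not depend on the
   expression b = w(alpha_i); off the roots they take a default value. *)
Definition coroot (b : X) : Y :=
  xget 0 [set c | exists w i, [/\ weyl w, b = w (sroot i) & c = coact w (scoroot i)]].

Definition root_refl (b : X) : aut X :=
  xget 1%g [set s | exists w i,
    [/\ weyl w, b = w (sroot i) & s = (w * srefl i * w^-1)%g]].

Definition inversions (w : aut X) : set X := pos_root `&` w @^-1` neg_root.

(** ** Coweights *)

Definition dominant : set Y := [set l | forall i, 0 <= << l, sroot i >>].

Definition tits : set Y :=
  [set l | exists w m, [/\ weyl w, dominant m & l = coact w m]].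

(* lambda^{++}, unique for lambda in Y^+; a default value elsewhere. *)
Definition dom_repr (l : Y) : Y :=
  xget 0 [set m | dominant m /\ exists2 w, weyl w & m = coact w l].

(** ** The affinized Weyl semigroup and the affinized roots

    The pair (l, w) stands for pi^l w, and (b, n) for b + n pi. *)

Definition wa_mul (x y : Y * aut X) : Y * aut X :=
  (x.1 + coact x.2 y.1, (x.2 * y.2)%g).

Definition wa_plus : set (Y * aut X) := [set x | tits x.1 /\ weyl x.2].

Definition aroot : set (X * int) := [set a | root a.1].

Definition pos_aroot : set (X * int) :=
  [set a | aroot a /\ (0 < a.2 \/ (a.2 = 0 /\ pos_root a.1))].

Definition wa_act (x : Y * aut X) (a : X * int) : X * int :=
  (x.2 a.1, a.2 + << x.1, x.2 a.1 >>).

Definition sgn (n : int) : int := if 0 <= n then 1 else -1.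

Definition pos_bracket_root (b : X) (n : int) : X * int := (sgn n *: b, `|n|).

(* b[n] *)
Definition bracket_root (b : X) (n : int) : X * int :=
  if b \in pos_root then pos_bracket_root b n else pos_bracket_root (- b) (- n).

(* s_{b[n]} *)
Definition aroot_refl (b : X) (n : int) : Y * aut X :=
  (n *: coroot b, root_refl b).

(** ** The affinized Bruhat order *)

Definition bruhat_step (x y : Y * aut X) : Prop :=
  exists b n, [/\ root b, wa_plus x, wa_plus y, y = wa_mul x (aroot_refl b n) &
                  pos_aroot (wa_act x (bracket_root b n))].

Definition bruhat_lt : Y * aut X -> Y * aut X -> Prop :=
  clos_trans (Y * aut X) bruhat_step.

Definition bruhat_le (x y : Y * aut X) : Prop := x = y \/ bruhat_lt x y.

Definition covers (y x : Y * aut X) : Prop :=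
  x <> y /\
  [set z | [/\ wa_plus z, bruhat_le x z & bruhat_le z y]] = [set x; y].

Definition strictly_compatible (len : Y * aut X -> rat) : Prop :=
  forall x y, wa_plus x -> wa_plus y ->
    bruhat_lt x y <-> (bruhat_le x y \/ bruhat_le y x) /\ len x < len y.

Definition Zgrading (len : Y * aut X -> rat) : Prop :=
  strictly_compatible len /\
  forall x y, wa_plus x -> wa_plus y ->
    covers y x <-> bruhat_le x y /\ len y = len x + 1.

(** ** Height and affinized length

    X (x) Q is represented by Q^n, n the rank of X, through the Z-basis
    [r2v (delta_mx 0 k)], k < n, of X; [bracketQ] is the Q-linear extension
    of the bracket. *)

Definition wtQ : Type := 'rV[rat]_(dim X).

Definition bracketQ (y : Y) (v : wtQ) : rat :=
  \sum_k v 0 k * (<< y, r2v (delta_mx 0 k) >>)%:~R.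

Lemma bracketQ_intr (y : Y) (x : X) :
  bracketQ y (map_mx intr (v2r x)) = (<< y, x >>)%:~R.
Proof.
have E : x = \sum_k v2r x 0 k *: r2v (delta_mx 0 k).
  rewrite -{1}(v2rK x) {1}(row_sum_delta (v2r x)) linear_sum.
  by apply: eq_bigr => k _; rewrite linearZ.
rewrite [in RHS]E /bracket linear_sum rmorph_sum; apply: eq_bigr => k _.
by rewrite mxE -rmorphM -bracketZr.
Qed.

Definition fundamental_weights (L : I -> wtQ) : Prop :=
  forall i j, bracketQ (scoroot i) (L j) = (i == j)%:R.

Definition ht (L : I -> wtQ) (l : Y) : rat := bracketQ l (\sum_i L i).

(* [fset_set] is meaningful on finite sets only; Inv(w^-1) is finite. *)
Definition alength (L : I -> wtQ) (x : Y * aut X) : rat :=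
  2 * ht L (dom_repr x.1)
  + #|` fset_set [set a | inversions (x.2^-1)%g a /\ 0 <= << x.1, a >>] |%:R
  - #|` fset_set [set a | inversions (x.2^-1)%g a /\ << x.1, a >> < 0] |%:R.

End RootDatum.

(* Main.v *)
From Stdlib Require Import Relation_Operators.
From mathcomp Require Import all_boot all_order all_algebra finmap.
From mathcomp Require Import boolp classical_sets cardinality.
From mathcomp Require Import zify ring lra.
Require Import Defs.

Set Implicit Arguments.
Unset Strict Implicit.
Unset Printing Implicit Defensive.

Import Order.TTheory GRing.Theory Num.Theory VectorInternalTheory.

Local Open Scope ring_scope.

Local Notation "<< y , x >>" := (bracket y x)
  (at level 0, y at level 99, x at level 99, format "<< y ,  x >>").

(** Let x < y be a generating relation of the affinized Bruhat order, say
    y = x s_a. The theorem is a formal consequence of two facts about it: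
    (1) l^a(y) - l^a(x) is a positive integer ([step_longer]), and
    (2) if this integer is not 1, some z satisfies x < z < y ([step_graded]).

    Both are proved by the same reduction. Left, or right, multiplication by a
    simple reflection s of W changes l^a by one, and maps x < y to another
    generating relation unless it exchanges x and y. As in a Coxeter group this
    gives a lifting property, by which (1) and (2) pass from (sx, sy) to (x, y)
    when x < sx, and from (xs, ys) to (x, y) when ys < y. After finitely many
    moves of the first kind the coweight lambda of x is dominant; then, after
    finitely many of the second kind, y = v2 pi^mu with mu dominant and v2 of
    minimal length modulo the stabilizer of mu ([reduce_steps],
    [rasc_dominant]).

    In that position x = y s_b with b = -theta + m pi, where theta is a positive
    root and 0 < m < N = <mu, theta>. One of v2 and v2 s_theta, call it v, sends
    theta to a positive root, and lambda = v(mu - n theta^vee) with n = m or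
    n = N - m and 2n <= N. Put a_t = <theta^vee, t>, p_t = <mu, t> and
    t' = - s_theta(t) = a_t theta - t for t in S = Inv(s_theta). The formulas
    ht(nu) - ht(v nu) = sum of <nu, t> over Inv(v), and
    2 ht(theta^vee) = sum of a_t over S, turn l^a(y) - l^a(x) into a sum over S
    of nonnegative terms, in which theta contributes 2n - 1
    ([alength_defect], [defect_ge0]). This is (1), and (2) remains to be shown
    when n > 1 or when some other t in S contributes; then a_t, p_t, p_t' >= 2.

    The intermediate elements are found in the coset of y under the dihedral
    group generated by s_b and s_c, for a well chosen c = -t + k pi. Since s_b
    is s_c s_b s_(c') as well as s_c s_d s_c, with c' = - s_b(c) and d = s_c(b),
    there are two candidates for a descending chain of length three from y to x
    ([chain_outer], [chain_inner]). Let q = <t^vee, theta>, which is positive. If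
    q = 1, one of them works for t or for t'. If q > 1, either one of them works
    for t or for t', or s = q t - theta and s' = q t' - theta form again a pair
    as above. As s' - s = q (t' - t), the second case cannot recur forever in the
    finite set S ([pair_not_cover]).

    The input from Coxeter groups is that every real root is positive or
    negative, with a coroot of the same sign ([simple_orbit_sign]). It is proved
    by induction on reduced words, which reduces it to rank two ([orbit_pos]). *)

(** * The pairing and the two actions *)

Section Pairing.
Variable D : root_datum.
Local Notation I := (idx D).
Local Notation X := (wt D).
Local Notation Y := (cowt D).

Implicit Types (x u v : X) (y l m : Y) (w g : aut X) (i j : I).

Lemma bracketDr y u v : << y, u + v >> = << y, u >> + << y, v >>.
Proof. by rewrite /bracket linearD. Qed.
Lemma bracketNr y u : << y, - u >> = - << y, u >>.
Proof. by rewrite /bracket linearN. Qed.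
Lemma bracket0r y : << y, 0 >> = 0 :> int.
Proof. by rewrite /bracket linear0. Qed.
Lemma bracketDl l m x : << l + m, x >> = << l, x >> + << m, x >>.
Proof. by rewrite /bracket linearD add_lfunE. Qed.
Lemma bracketNl l x : << - l, x >> = - << l, x >>.
Proof. by rewrite /bracket linearN opp_lfunE. Qed.
Lemma bracketBl l m x : << l - m, x >> = << l, x >> - << m, x >>.
Proof. by rewrite bracketDl bracketNl. Qed.
Lemma bracketZl a l x : << a *: l, x >> = a * << l, x >>.
Proof. by rewrite /bracket linearZ scale_lfunE. Qed.
Lemma bracket0l x : << 0, x >> = 0 :> int.
Proof. by rewrite /bracket linear0 zero_lfunE. Qed.

Lemma bracket_sumr (J : finType) (F : J -> X) y :
  << y, \sum_j F j >> = \sum_j << y, F j >>.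
Proof. exact: (big_morph (bracket y) (bracketDr y) (bracket0r y)). Qed.

Lemma cowt_inj l m : (forall x, << l, x >> = << m, x >>) -> l = m.
Proof. by move=> e; apply: (can_inj (@dualityK D)); apply/lfunP => x; exact: e. Qed.

Lemma autD w u v : w (u + v) = w u + w v.
Proof. exact: linearD. Qed.
Lemma autN w u : w (- u) = - w u.
Proof. exact: linearN. Qed.
Lemma autB w u v : w (u - v) = w u - w v.
Proof. exact: linearB. Qed.
Lemma autZ w a u : w (a *: u) = a *: w u.
Proof. exact: linearZ. Qed.
Lemma aut0 w : w 0 = 0.
Proof. exact: linear0. Qed.
Lemma aut_sum (J : finType) w (F : J -> X) : w (\sum_j F j) = \sum_j w (F j).
Proof. exact: (big_morph w (autD w) (aut0 w)). Qed.
Lemma autK w : cancel w (w^-1)%g.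
Proof. by move=> x; rewrite -aut_mulE mulVg aut_oneE. Qed.
Lemma autVK w : cancel (w^-1)%g w.
Proof. by move=> x; rewrite -aut_mulE mulgV aut_oneE. Qed.
Lemma aut_inj w : injective w.
Proof. exact: can_inj (autK w). Qed.

Lemma coactD w l m : coact w (l + m) = coact w l + coact w m.
Proof. by apply: cowt_inj => x; rewrite bracketDl !bracket_coact bracketDl. Qed.
Lemma coactN w l : coact w (- l) = - coact w l.
Proof. by apply: cowt_inj => x; rewrite bracketNl !bracket_coact bracketNl. Qed.
Lemma coactB w l m : coact w (l - m) = coact w l - coact w m.
Proof. by rewrite coactD coactN. Qed.
Lemma coactZ w a l : coact w (a *: l) = a *: coact w l.
Proof. by apply: cowt_inj => x; rewrite bracketZl !bracket_coact bracketZl. Qed.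
Lemma coact0 w : coact w (0 : Y) = 0.
Proof. by apply: cowt_inj => x; rewrite bracket_coact !bracket0l. Qed.
Lemma coactM g w l : coact (g * w)%g l = coact g (coact w l).
Proof. by apply: cowt_inj => x; rewrite !bracket_coact invgM aut_mulE. Qed.
Lemma coact1 l : coact (1%g : aut X) l = l.
Proof. by apply: cowt_inj => x; rewrite bracket_coact invg1 aut_oneE. Qed.
Lemma coactK w : cancel (coact w) (@coact D (w^-1)%g).
Proof. by move=> l; rewrite -coactM mulVg coact1. Qed.
Lemma coactVK w : cancel (@coact D (w^-1)%g) (coact w).
Proof. by move=> l; rewrite -coactM mulgV coact1. Qed.

Lemma srefl_inv i : (srefl i : aut X)^-1%g = srefl i.
Proof. by apply: val_inj. Qed.
Lemma sreflK i : (srefl i * srefl i = 1 :> aut X)%g.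
Proof. by rewrite -{1}srefl_inv mulVg. Qed.
Lemma srefl_root i : srefl i (sroot i) = - sroot i.
Proof. by rewrite sreflE bracket_ii -[X in X - _]scale1r -scalerBl scaleN1r. Qed.

(** * Words in the simple reflections *)

Definition wprod (s : seq I) : aut X := foldr (fun i w => srefl i * w)%g 1%g s.

Lemma wprod_cat s t : wprod (s ++ t) = (wprod s * wprod t)%g.
Proof. by elim: s => [|i s IH] /=; rewrite ?mul1g // IH mulgA. Qed.
Lemma wprod_rcons s i : wprod (rcons s i) = (wprod s * srefl i)%g.
Proof. by rewrite -cats1 wprod_cat /= mulg1. Qed.
Lemma wprod_rev s : wprod (rev s) = (wprod s)^-1%g.
Proof.
elim: s => [|i s IH] /=; first by rewrite invg1.
by rewrite rev_cons wprod_rcons IH invgM srefl_inv.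
Qed.

Lemma weyl_wprod s : weyl (wprod s).
Proof. by elim: s => [|i s IH] /=; [exact: weyl_one | apply: weyl_mul IH; exact: weyl_srefl]. Qed.

Lemma weylP w : weyl w -> exists s, w = wprod s.
Proof.
elim=> [i||v1 v2 _ [s ->] _ [t ->]|v _ [s ->]].
- by exists [:: i]; rewrite /= mulg1.
- by exists [::].
- by exists (s ++ t); rewrite wprod_cat.
- by exists (rev s); rewrite wprod_rev.
Qed.

Definition reduced (s : seq I) := forall t, wprod t = wprod s -> (size s <= size t)%N.

Lemma exists_reduced w : weyl w -> exists2 s, w = wprod s & reduced s.
Proof.
move/weylP => ex.
have ex' : exists n, `[< exists s, size s = n /\ w = wprod s >].
  by case: ex => s e; exists (size s); apply/asboolP; exists s.
case: (ex_minnP ex') => n /asboolP[s [sn e]] mn; exists s => // t te.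
by rewrite sn; apply: mn; apply/asboolP; exists t; rewrite te.
Qed.

(** Letters are added on the left, so the last letter is always i and the
    parity of the length decides the first one. *)
Fixpoint alt (i j : I) (n : nat) : seq I :=
  if n is n'.+1 then (if odd n' then j else i) :: alt i j n' else [::].

Lemma size_alt i j n : size (alt i j n) = n.
Proof. by elim: n => //= n ->. Qed.

Lemma alt_rcons i j n : alt i j n.+1 = rcons (alt j i n) i.
Proof.
elim: n => // n IH; rewrite [LHS]/= -/(alt i j n.+1) IH /=.
by case: (odd n).
Qed.

Section Braid.
Variables (i j : I).
Local Notation a := (cartan i j).
Local Notation b := (cartan j i).

(* On x + Z alpha_i + Z alpha_j a simple reflection only changes one
   coordinate, by an affine form in the two coordinates. *)
Lemma srefl_plane_i x (p q : int) :
  srefl i (x + p *: sroot i + q *: sroot j)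
  = x + (- p - << scoroot i, x >> - a * q) *: sroot i + q *: sroot j.
Proof.
rewrite sreflE !bracketDr !bracketZr bracket_ii /bracket cartanE -/(bracket _ _).
have -> : - p - << scoroot i, x >> - a * q = p - (<< scoroot i, x >> + p * 2 + q * a) by ring.
by rewrite scalerBl -!addrA; congr (_ + (_ + _)); rewrite addrC.
Qed.
Lemma srefl_plane_j x (p q : int) :
  srefl j (x + p *: sroot i + q *: sroot j)
  = x + p *: sroot i + (- q - << scoroot j, x >> - b * p) *: sroot j.
Proof.
rewrite sreflE !bracketDr !bracketZr bracket_ii /bracket cartanE -/(bracket _ _).
have -> : - q - << scoroot j, x >> - b * p = q - (<< scoroot j, x >> + p * b + q * 2) by ring.
by rewrite scalerBl -!addrA.
Qed.

(** Both sides move a weight x inside x + Z alpha_i + Z alpha_j, and the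
    coordinates of the images are computed explicitly. The pairings of x with the
    two coroots are arbitrary, so the relation holds on all of X and not only on
    the plane of the two roots. *)
Lemma braid n : [\/ a = 0 /\ b = 0 /\ n = 2%N, a = -1 /\ b = -1 /\ n = 3%N,
   (a = -1 /\ b = -2 \/ a = -2 /\ b = -1) /\ n = 4%N |
   (a = -1 /\ b = -3 \/ a = -3 /\ b = -1) /\ n = 6%N] ->
  wprod (alt i j n) = wprod (alt j i n).
Proof.
move=> H; apply: autP => x.
have {1 2}-> : x = x + 0 *: sroot i + 0 *: sroot j by rewrite !scale0r !addr0.
case: H => [[ea [eb ->]]|[ea [eb ->]]|[[[ea eb]|[ea eb]] ->]|[[[ea eb]|[ea eb]] ->]] /=;
rewrite ?mulg1 ?aut_mulE ?(srefl_plane_i, srefl_plane_j) ea eb;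
by congr (_ + _ *: _ + _ *: _); ring.
Qed.
End Braid.

End Pairing.

(** * Signs in rank two *)

(** The coordinates of the image of alpha_i under the alternating word of length
    n ending in s_j, where -a and -b are the two off-diagonal Cartan entries. *)
Fixpoint rank2_coef (a b : int) (n : nat) : int * int :=
  if n is n'.+1 then
    let: (c, d) := rank2_coef a b n' in
    if odd n' then (- c + a * d, d) else (c, - d + b * c)
  else (1, 0).

(** The coordinate changed last, say d, satisfies b c <= 2 d. As 4 <= a b, this gives
    2 c <= a d, which yields both the positivity of the next coordinate a d - c and
    the next instance of the bound. *)
Lemma rank2_coef_ge0_inf a b n : 0 <= a -> 0 <= b -> 4 <= a * b ->
  let: (c, d) := rank2_coef a b n in
  [/\ 0 <= c, 0 <= d & if odd n then b * c <= 2 * d else a * d <= 2 * c].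
Proof.
move=> a0 b0 ab; elim: n => [|n] /=; first by split=> //; rewrite mulr0.
case: (rank2_coef a b n) => c d; case: ifP => on /= [c0 d0 H].
  have H2 : 2 * c <= a * d by nia.
  by split=> //; nia.
have H2 : 2 * d <= b * c by nia.
by split=> //; nia.
Qed.

(** The order of s_i s_j, in terms of the product of the Cartan entries when that
    product is less than 4. *)
Definition bond (p : int) : nat :=
  (if p == 0 then 2 else if p == 1 then 3 else if p == 2 then 4 else 6)%N.

Lemma rank2_cases (a b : int) : 0 <= a -> 0 <= b -> (a = 0 <-> b = 0) -> a * b < 4 ->
  [\/ a = 0 /\ b = 0, a = 1 /\ b = 1,
     a = 1 /\ b = 2 \/ a = 2 /\ b = 1 | a = 1 /\ b = 3 \/ a = 3 /\ b = 1].
Proof.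
move=> a0 b0 [z1 z2] ab.
have [e|na] := eqVneq a 0; first by apply: Or41; split=> //; exact: z1.
have nb : b != 0 by apply/eqP => /z2/eqP; apply/negP.
have a1 : 1 <= a by lia.
have b1 : 1 <= b by lia.
have a3 : a <= 3 by nia.
have b3 : b <= 3 by nia.
have [e|/eqP n1] := eqVneq a 1.
  have [e'|/eqP m1] := eqVneq b 1; first by apply: Or42; do !split.
  have [e'|/eqP m2] := eqVneq b 2; first by apply: Or43; left.
  by apply: Or44; left; split=> //; lia.
have e' : b = 1 by nia.
have [e|/eqP m2] := eqVneq a 2; first by apply: Or43; right.
by apply: Or44; right; split=> //; lia.
Qed.

Lemma rank2_coef_ge0_fin a b n : 0 <= a -> 0 <= b -> (a = 0 <-> b = 0) ->
  a * b < 4 -> (n < bond (a * b))%N ->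
  let: (c, d) := rank2_coef a b n in 0 <= c /\ 0 <= d.
Proof.
move=> a0 b0 z ab.
case: (rank2_cases a0 b0 z ab) => [[-> ->]|[-> ->]|[[-> ->]|[-> ->]]|[[-> ->]|[-> ->]]];
by do 6?[case: n => [|n] //].
Qed.

(** * Positivity along reduced words *)

Section PositiveOrbit.
Variable D : root_datum.
Local Notation I := (idx D).
Local Notation X := (wt D).

(* V stands for X with the simple roots, and for Y with the simple coroots: the
   same induction gives the sign of a root and the sign of its coroot. *)
Variables (V : lmodType int) (e : I -> V) (B : I -> I -> int).
Variable act : aut X -> V -> V.
Hypothesis act1 : forall v, act 1%g v = v.
Hypothesis actM : forall g h v, act (g * h)%g v = act g (act h v).
Hypothesis actD : forall g u v, act g (u + v) = act g u + act g v.
Hypothesis actZ : forall g a v, act g (a *: v) = a *: act g v.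
Hypothesis act_srefl : forall i j, act (srefl i) (e j) = e j - B i j *: e i.
Hypothesis B_ii : forall i, B i i = 2.
Hypothesis B_le0 : forall i j, i != j -> B i j <= 0.
Hypothesis B_eq0 : forall i j, B i j = 0 <-> B j i = 0.
Hypothesis B_cartan : forall i j, B i j = cartan i j /\ B j i = cartan j i
  \/ B i j = cartan j i /\ B j i = cartan i j.

Definition nncomb (v : V) := exists2 c : I -> int, (forall i, 0 <= c i) & v = \sum_i c i *: e i.

Lemma nncombD u v : nncomb u -> nncomb v -> nncomb (u + v).
Proof.
move=> [c c0 ->] [d d0 ->]; exists (fun i => c i + d i); first by move=> i; rewrite addr_ge0.
by rewrite -big_split; apply: eq_bigr => i _; rewrite scalerDl.
Qed.
Lemma nncombZ a v : 0 <= a -> nncomb v -> nncomb (a *: v).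
Proof.
move=> a0 [c c0 ->]; exists (fun i => a * c i); first by move=> i; rewrite mulr_ge0.
by rewrite scaler_sumr; apply: eq_bigr => i _; rewrite scalerA.
Qed.
Lemma nncomb_gen i : nncomb (e i).
Proof.
exists (fun j => (j == i)%:R); first by move=> j; case: eqP.
rewrite (bigD1 i) //= eqxx scale1r big1 ?addr0 // => j /negPf ->.
by rewrite scale0r.
Qed.

Lemma act_srefl_comb i j (c d : int) :
  act (srefl i) (c *: e i + d *: e j) = (- c - B i j * d) *: e i + d *: e j.
Proof.
have e1 : c *: (e i - 2 *: e i) = - c *: e i.
  by rewrite -[X in X - _]scale1r -scalerBl scalerA; congr (_ *: _); ring.
rewrite actD !actZ !act_srefl B_ii e1 scalerBr scalerA scalerBl addrCA addrC mulrC.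
by rewrite -addrA [_ + d *: _]addrC addrA.
Qed.

Lemma act_alt i j n : i != j -> let: (c, d) := rank2_coef (- B i j) (- B j i) n in
  act (wprod (alt j i n)) (e i) = c *: e i + d *: e j.
Proof.
move=> ij; elim: n => [|n] /=; first by rewrite act1 scale1r scale0r addr0.
case: (rank2_coef _ _ n) => c d IH.
rewrite actM IH; case: ifP => on.
  by rewrite act_srefl_comb mulNr.
by rewrite addrC act_srefl_comb addrC mulNr.
Qed.

Lemma bond_braid i j : i != j -> B i j * B j i < 4 ->
  wprod (alt i j (bond (B i j * B j i))) = wprod (alt j i (bond (B i j * B j i))) :> aut X.
Proof.
move=> ij lt4.
have z : - B i j = 0 <-> - B j i = 0.
  by split=> /eqP; rewrite oppr_eq0 => /eqP /B_eq0 ->; rewrite oppr0.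
have p1 : 0 <= - B i j by rewrite oppr_ge0 B_le0.
have p2 : 0 <= - B j i by rewrite oppr_ge0 B_le0 // eq_sym.
have lt4' : - B i j * - B j i < 4 by rewrite mulrNN.
have {z p1 p2 lt4 lt4'} := rank2_cases p1 p2 z lt4'.
have N (p q : int) : - p = q -> p = - q by move=> <-; rewrite opprK.
case: (B_cartan i j) => -[-> ->] [[/N q1 /N q2]|[/N q1 /N q2]|[] [/N q1 /N q2]|[] [/N q1 /N q2]];
  apply: braid; rewrite q1 q2 ?oppr0;
  [apply: Or41 | apply: Or42 | apply: Or43 | apply: Or43 | apply: Or44 | apply: Or44
  |apply: Or41 | apply: Or42 | apply: Or43 | apply: Or43 | apply: Or44 | apply: Or44];
  split=> //; auto.
Qed.

(** A braid relation exposes the first letter twice, so an alternating word longer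
    than the order of s_i s_j is not reduced. *)
Lemma bond_braid_shorten i j : i != j -> B i j * B j i < 4 -> let m := bond (B i j * B j i) in
  wprod (alt i j m.+1) = wprod (alt j i m.-1) :> aut X.
Proof.
move=> ij lt4; set m := bond _ => /=.
have [m' em] : exists m', m = m'.+1.
  by rewrite /m /bond; do 3?case: ifP => _; eexists.
rewrite bond_braid // -/m em /=; case: (odd m') => /=;
by rewrite mulgA sreflK mul1g.
Qed.

(** Equal neighbours in d would cancel, and a last letter i would be cancelled by
    the letter that may be appended. *)
Lemma alternating_suffix i j d v : i != j ->
  {subset d <= [:: i; j]} -> reduced (v ++ d) ->
  (forall t, wprod t = wprod (rcons (v ++ d) i) :> aut X -> (size (v ++ d) <= size t)%N) ->
  d = alt j i (size d).
Proof.
move=> ij; elim: d v => [|x d IH] v sd red rci //.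
have sd' : {subset d <= [:: i; j]} by move=> y yd; apply: sd; rewrite inE yd orbT.
have ecat : rcons v x ++ d = v ++ x :: d by rewrite cat_rcons.
have dE := IH (rcons v x) sd'; rewrite ecat in dE; have {}dE := dE red rci.
have xij : x = i \/ x = j.
  by move: (sd x); rewrite !inE eqxx => /(_ isT) /orP[/eqP|/eqP]; auto.
case: d dE {IH sd' ecat} sd red rci => [_ | y d dE] sd red rci.
  case: xij => xi; last by rewrite xi.
  have := rci v; rewrite xi cats1 !wprod_rcons -mulgA sreflK mulg1.
  by move=> /(_ erefl); rewrite size_rcons ltnn.
have xy : x <> y.
  move=> exy; have := red (v ++ d); rewrite !wprod_cat exy /=.
  rewrite [(srefl y * (srefl y * _))%g]mulgA sreflK mul1g => /(_ erefl).
  by rewrite !size_cat /= !addnS; lia.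
have -> : alt j i (size [:: x, y & d])
    = (if odd (size (y :: d)) then i else j) :: alt j i (size (y :: d)) by [].
rewrite -dE; congr (_ :: _); move: dE xy xij => /= [-> _].
by case: (odd (size d)) => /= xy [] // ->.
Qed.

(** If s s_i is not shorter than s, then s sends alpha_i to a nonnegative
    combination of simple roots. Let j be the last letter of s, and write
    s = v d with d a word in i and j and v as short as possible. Then v cannot be
    shortened by s_i or s_j on the right, so by induction it sends alpha_i and
    alpha_j to nonnegative combinations; and d, being alternating and of length
    less than the order of s_i s_j, sends alpha_i to a nonnegative combination of
    alpha_i and alpha_j. *)
Lemma orbit_pos s i : reduced s ->
  (forall t, wprod t = wprod (rcons s i) :> aut X -> (size s <= size t)%N) ->
  nncomb (act (wprod s) (e i)).
Proof.
have [n] := ubnP (size s); elim: n => // n IH in s i *; rewrite ltnS => sn red rci.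
case: (lastP s) => [|s' j] in sn red rci *.
  by rewrite act1; exact: nncomb_gen.
have ij : i != j.
  apply/eqP => eij; have := rci s'; rewrite eij !wprod_rcons -mulgA sreflK mulg1.
  by move=> /(_ erefl); rewrite size_rcons ltnn.
set r := rcons s' j in sn red rci *.
(* The lengths of the possible prefixes v of a factorization as above. *)
pose P k := `[< exists v d, [/\ size v = k, wprod (v ++ d) = wprod r :> aut X,
  (size v + size d = size r)%N & {subset d <= [:: i; j]}] >].
have P0 : P (size s').
  apply/asboolP; exists s', [:: j]; split=> //; first by rewrite cats1.
    by rewrite /r size_rcons addn1.
  by move=> x; rewrite !inE orbC => /eqP ->; rewrite eqxx.
case: (ex_minnP (ex_intro P _ P0)) => k /asboolP[v [d [vk vds sz dij]]] kmin.
have ks : (k < size r)%N by rewrite /r size_rcons ltnS; exact: kmin.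
have redv : reduced v.
  move=> t tv; have := red (t ++ d); rewrite wprod_cat tv -wprod_cat => /(_ vds).
  by rewrite size_cat -sz leq_add2r.
have extv x : x \in [:: i; j] ->
    forall t, wprod t = wprod (rcons v x) :> aut X -> (size v <= size t)%N.
  move=> xij t tv; rewrite leqNgt; apply/negP => tlt.
  have e1 : wprod (t ++ x :: d) = wprod r :> aut X.
    by rewrite -vds !wprod_cat tv wprod_rcons /= mulgA -[(_ * srefl x * srefl x)%g]mulgA
      sreflK mulg1.
  have l1 : (size t + (size d).+1 = size r)%N.
    apply/eqP; rewrite eqn_leq; apply/andP; split; first by rewrite -sz; lia.
    by have := red _ e1; rewrite size_cat.
  have := kmin (size t); rewrite -vk leqNgt tlt /=; move/(_ _)/notF; apply.
  apply/asboolP; exists t, (x :: d); split=> //.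
  by move=> y; rewrite inE => /orP[/eqP ->//|/dij].
have vi : nncomb (act (wprod v) (e i)).
  by apply: IH => //; [rewrite vk; lia | apply: extv; rewrite !inE eqxx].
have vj : nncomb (act (wprod v) (e j)).
  by apply: IH => //; [rewrite vk; lia | apply: extv; rewrite !inE eqxx orbT].
have redvd : reduced (v ++ d).
  by move=> t tv; rewrite size_cat sz; apply: red; rewrite tv.
have rcivd t : wprod t = wprod (rcons (v ++ d) i) :> aut X -> (size (v ++ d) <= size t)%N.
  by rewrite size_cat sz wprod_rcons vds -wprod_rcons => /rci.
have dE := alternating_suffix ij dij redvd rcivd.
have p1 : 0 <= - B i j by rewrite oppr_ge0 B_le0.
have p2 : 0 <= - B j i by rewrite oppr_ge0 B_le0 // eq_sym.
have coefs : let: (c, d) := rank2_coef (- B i j) (- B j i) (size d) in 0 <= c /\ 0 <= d.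
  have [le4|lt4] := lerP 4 (- B i j * - B j i).
    by move: (rank2_coef_ge0_inf (size d) p1 p2 le4); case: (rank2_coef _ _ _) => ? ? [].
  have z : - B i j = 0 <-> - B j i = 0.
    by split=> /eqP; rewrite oppr_eq0 => /eqP /B_eq0 ->; rewrite oppr0.
  suff nb : (size d < bond (- B i j * - B j i))%N
    by move: (rank2_coef_ge0_fin p1 p2 z lt4 nb); case: (rank2_coef _ _ _).
  rewrite ltnNge; apply/negP.
  rewrite mulrNN in lt4 *; set m := bond _ => md.
  have m_gt0 : (0 < m)%N by rewrite /m /bond; do 3?case: ifP => _.
  have alt_suffix k' l : exists p, alt i j (k' + l) = p ++ alt i j l.
    elim: k' => [|k' [p IHk]]; first by exists [::].
    by rewrite addSn /= IHk; eexists (_ :: p).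
  have [p pE] := alt_suffix (size d - m)%N m.+1.
  have szp : (size p = size d - m)%N.
    by have := congr1 size pE; rewrite size_cat !size_alt; lia.
  have := rcivd (v ++ p ++ alt j i m.-1).
  rewrite -cats1 -catA cats1 dE -alt_rcons.
  have -> : (size d).+1 = (size d - m + m.+1)%N by lia.
  rewrite pE !wprod_cat bond_braid_shorten // => /(_ erefl).
  rewrite !size_cat !size_alt szp leq_add2l.
  by case: (m) m_gt0 md => // m' _ md' /=; lia.
rewrite -vds wprod_cat actM dE.
have := act_alt (size d) ij; move: coefs; case: (rank2_coef _ _ _) => c c' [c0 c'0] ->.
by rewrite actD !actZ; apply: nncombD; apply: nncombZ.
Qed.

End PositiveOrbit.

(** * Real roots and coroots *)

Local Notation nnX := (nncomb (@sroot _)).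
Local Notation nnY := (nncomb (@scoroot _)).

Section Roots.
Variable D : root_datum.
Local Notation I := (idx D).
Local Notation X := (wt D).
Local Notation Y := (cowt D).
Implicit Types (x u b : X) (y l m : Y) (w v g : aut X) (i j k : I).

Lemma bracket_simple i j : << scoroot i, sroot j >> = cartan i j.
Proof. exact: cartanE. Qed.

Lemma sroot_coef_inj (c d : I -> int) :
  \sum_i c i *: sroot i = \sum_i d i *: sroot i :> X -> c =1 d.
Proof.
move=> e i; apply/eqP; rewrite -subr_eq0; apply/eqP.
apply: (@sroot_indep D (fun i => c i - d i)).
by rewrite (eq_bigr _ (fun i _ => scalerBl _ _ _)) sumrB e subrr.
Qed.

Lemma nnX_anti u : nnX u -> nnX (- u) -> u = 0.
Proof.
move=> [c c0 ->] [d d0 e].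
have H : c =1 (fun i => - d i).
  by apply: sroot_coef_inj; rewrite -[LHS]opprK e -sumrN; apply: eq_bigr => i _; rewrite scaleNr.
rewrite big1 // => i _; suff -> : c i = 0 by rewrite scale0r.
by apply/eqP; rewrite eq_le c0 H oppr_le0 d0.
Qed.

Lemma orbit_pos_X s i : reduced s ->
  (forall t, wprod t = wprod (rcons s i) :> aut X -> (size s <= size t)%N) ->
  nnX (wprod s (sroot i)).
Proof.
have [c1 c2 c3] := cartanP D.
apply: (@orbit_pos D X (@sroot D) (@cartan D) (fun w x => w x)) => //.
- exact: aut_oneE.
- exact: aut_mulE.
- exact: autD.
- exact: autZ.
- by move=> i' j; rewrite sreflE bracket_simple.
- by left.
Qed.

Lemma orbit_pos_Y s i : reduced s ->
  (forall t, wprod t = wprod (rcons s i) :> aut X -> (size s <= size t)%N) ->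
  nnY (coact (wprod s) (scoroot i)).
Proof.
have [c1 c2 c3] := cartanP D.
apply: (@orbit_pos D Y (@scoroot D) (fun i j => cartan j i) (@coact D)) => //.
- exact: coact1.
- exact: coactM.
- exact: coactD.
- exact: coactZ.
- by move=> i' j; rewrite coact_srefl bracket_simple.
- by move=> i' j; rewrite eq_sym => /c2.
- by right.
Qed.

(** One of w and w s_i is the shorter one; [orbit_pos] applies to it, and the two
    images of alpha_i are opposite. *)
Lemma simple_orbit_sign w i : weyl w ->
  (nnX (w (sroot i)) /\ nnY (coact w (scoroot i))) \/
  (nnX (- w (sroot i)) /\ nnY (- coact w (scoroot i))).
Proof.
move=> ww; have [s ws rs] := exists_reduced ww.
have wi : weyl (w * srefl i)%g by apply: weyl_mul ww _; exact: weyl_srefl.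
have [t wt rt] := exists_reduced wi.
have [le|lt] := leqP (size s) (size t).
  left; rewrite ws; split; [apply: orbit_pos_X|apply: orbit_pos_Y] => // t' e;
  by apply: leq_trans le _; apply: rt; rewrite e wprod_rcons -ws wt.
have wE : w = wprod (rcons t i) by rewrite wprod_rcons -wt -mulgA sreflK mulg1.
right; rewrite wE wprod_rcons aut_mulE srefl_root autN opprK coactM coact_srefl bracket_ii.
have -> : scoroot i - 2 *: scoroot i = - scoroot i :> Y.
  by rewrite -[X in X - _]scale1r -scalerBl -scaleN1r.
by rewrite coactN opprK; split; [apply: orbit_pos_X|apply: orbit_pos_Y] => // t' e;
   apply: leq_trans (ltnW lt) _; apply: rs; rewrite -ws wE e.
Qed.

(* The last letter i of a reduced word for w. *)
Lemma weyl_neq1 w : weyl w -> w <> 1%g -> exists i, nnX (- w (sroot i)).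
Proof.
move=> ww w1; have [s ws rs] := exists_reduced ww.
case: (lastP s) => [|s' i] in ws rs *; first by rewrite ws in w1.
exists i; rewrite ws wprod_rcons aut_mulE srefl_root autN opprK.
apply: orbit_pos_X => t e.
  have := rs (rcons t i); rewrite !wprod_rcons e => /(_ erefl).
  by rewrite !size_rcons.
by have := rs t e; rewrite size_rcons => /ltnW.
Qed.

Lemma sroot_neq0 i : sroot i != 0 :> X.
Proof. by apply/eqP => e; have := bracket_ii i; rewrite e bracket0r. Qed.

Lemma nnX_pos b : nnX b -> root b -> pos_root b.
Proof.
move=> [c c0 e] rb; split=> //; exists (fun i => absz (c i)).
by rewrite e; apply: eq_bigr => i _; rewrite -[c i in LHS]gez0_abs // -natz scaler_nat.
Qed.
Lemma pos_nnX b : pos_root b -> nnX b.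
Proof.
move=> [_ [c ->]]; exists (fun i => (c i)%:Z) => //.
by apply: eq_bigr => i _; rewrite -scaler_nat natz.
Qed.
Lemma pos_root_root b : pos_root b -> root b. Proof. by case. Qed.

Lemma root_act w b : weyl w -> root b -> root (w b).
Proof.
move=> ww [v [i [wv ->]]]; exists (w * v)%g, i; split; first exact: weyl_mul.
by rewrite aut_mulE.
Qed.
Lemma root_opp b : root b -> root (- b).
Proof.
move=> [v [i [wv ->]]]; exists (v * srefl i)%g, i; split.
  by apply: weyl_mul wv _; exact: weyl_srefl.
by rewrite aut_mulE srefl_root autN.
Qed.
Lemma root_simple i : root (sroot i : X).
Proof. by exists 1%g, i; rewrite aut_oneE; split=> //; exact: weyl_one. Qed.
Lemma pos_simple i : pos_root (sroot i : X).
Proof. apply: nnX_pos (root_simple i); exact: nncomb_gen. Qed.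

Lemma root_neq0 b : root b -> b != 0.
Proof.
move=> [w [i [_ ->]]]; apply: contra (sroot_neq0 i) => /eqP e.
by rewrite -[sroot i](autK w) e aut0.
Qed.

Lemma root_sign b : root b -> pos_root b \/ pos_root (- b).
Proof.
move=> rb; case: (rb) => w [i [ww be]].
case: (simple_orbit_sign i ww) => -[H _]; [left|right]; first by apply: nnX_pos rb; rewrite be.
by apply: nnX_pos (root_opp rb); rewrite be.
Qed.
Lemma pos_anti b : pos_root b -> pos_root (- b) -> False.
Proof.
move=> pb nb; have := root_neq0 (pos_root_root pb).
by rewrite (nnX_anti (pos_nnX pb) (pos_nnX nb)) eqxx.
Qed.
Lemma posN b : root b -> ~ pos_root b <-> pos_root (- b).
Proof.
move=> rb; split=> [np|nb pb]; last exact: pos_anti pb nb.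
by case: (root_sign rb).
Qed.

Lemma srefl_coroot i : coact (srefl i) (scoroot i) = - scoroot i :> Y.
Proof.
by rewrite coact_srefl bracket_ii -[X in X - _]scale1r -scalerBl -scaleN1r.
Qed.

Lemma int_scale0 (V : vectType int) (a : int) (v : V) : a *: v = 0 -> v != 0 -> a = 0.
Proof.
move=> e nv; have /eqP : a *: v2r v = 0 by rewrite -linearZ e linear0.
move=> /eqP/rowP H.
have : v2r v != 0 by apply: contra nv => /eqP e0; rewrite -[v]v2rK e0 linear0.
case/rV0Pn => k nk; have := H k; rewrite !mxE => /eqP.
by rewrite mulf_eq0 (negPf nk) orbF => /eqP.
Qed.

(** The reflection along alpha_j is determined by alpha_j: two of them differ by
    an element fixing alpha_j and adding multiples of alpha_j to the other simple
    roots, hence without inversions. *)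
Lemma srefl_unique g i j : weyl g -> g (sroot i) = sroot j ->
  coact g (scoroot i) = scoroot j /\ (g * srefl i * g^-1 = srefl j)%g.
Proof.
move=> wg gij; pose h := (srefl j * (g * srefl i * g^-1))%g.
have hE x : h x = x + (<< coact g (scoroot i), x >> - << scoroot j, x >>) *: sroot j.
  rewrite /h !aut_mulE [srefl i _]sreflE (autB g) autVK (autZ g) gij.
  have -> : << scoroot i, (g^-1)%g x >> = << coact g (scoroot i), x >> by rewrite bracket_coact.
  rewrite autB autZ srefl_root sreflE scalerBl scalerN opprK -addrA; congr (_ + _).
  by rewrite addrC.
have gj : << coact g (scoroot i), sroot j >> = 2 by rewrite -gij bracket_invariant bracket_ii.
have wh : weyl h.
  apply: weyl_mul (weyl_srefl j) _; apply: weyl_mul (weyl_inv wg).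
  exact: weyl_mul wg (weyl_srefl i).
have h1 : h = 1%g.
  apply: contrapT => /(weyl_neq1 wh) [k]; rewrite hE.
  have [-> |kj] := eqVneq k j.
    rewrite gj bracket_ii subrr scale0r addr0 => H.
    by have := sroot_neq0 j; rewrite (nnX_anti (nncomb_gen _ j) H) eqxx.
  set a := _ - _ => -[c c0 e]; have /sroot_coef_inj/(_ k) :
     \sum_i c i *: sroot i = \sum_i (- ((i == k)%:R + a * (i == j)%:R)) *: sroot i :> X.
    rewrite -e; under eq_bigr => i' _ do rewrite scaleNr scalerDl.
    rewrite sumrN big_split /=; congr (- (_ + _)).
      by rewrite (bigD1 k) //= eqxx scale1r big1 ?addr0 // => i' /negPf ->; rewrite scale0r.
    rewrite (bigD1 j) //= eqxx mulr1 big1 ?addr0 // => i' /negPf ->.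
    by rewrite mulr0 scale0r.
  by rewrite eqxx (negPf kj) mulr0 addr0 => ek; have := c0 k; rewrite ek.
split; last first.
  by rewrite -[RHS]mulg1 -h1 /h [RHS]mulgA sreflK mul1g.
apply: cowt_inj => x; apply/eqP; rewrite -subr_eq0; apply/eqP.
apply: int_scale0 (sroot_neq0 j); apply: (addrI x).
by rewrite -hE h1 aut_oneE addr0.
Qed.

(** Hence coroots and reflections do not depend on how a root is written as
    w(alpha_i). *)
Lemma orbit_coroot w v i j : weyl w -> weyl v -> w (sroot i) = v (sroot j) ->
  coact w (scoroot i) = coact v (scoroot j) /\ (w * srefl i * w^-1 = v * srefl j * v^-1)%g.
Proof.
move=> ww wv e.
have wg : weyl (v^-1 * w)%g by apply: weyl_mul ww; exact: weyl_inv.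
have gij : (v^-1 * w)%g (sroot i) = sroot j by rewrite aut_mulE e autK.
have [c1 c2] := srefl_unique wg gij; split.
  by rewrite -c1 coactM coactVK.
by rewrite -c2 invgM invgK !mulgA mulgV mul1g -!mulgA mulgV mulg1.
Qed.

Lemma coroot_orbit w i : weyl w -> coroot (w (sroot i)) = coact w (scoroot i).
Proof.
move=> ww; rewrite /coroot; case: xgetP => [c _ [v [j [wv e ->]]]|/(_ (coact w (scoroot i)))].
  by have [->] := orbit_coroot ww wv e.
by case; exists w, i.
Qed.
Lemma root_refl_orbit w i : weyl w -> root_refl (w (sroot i)) = (w * srefl i * w^-1)%g.
Proof.
move=> ww; rewrite /root_refl; case: xgetP => [c _ [v [j [wv e ->]]]|/(_ (w * srefl i * w^-1)%g)].
  by have [_ ->] := orbit_coroot ww wv e.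
by case; exists w, i.
Qed.

Lemma root_refl_simple i : root_refl (sroot i) = srefl i :> aut X.
Proof.
rewrite -[sroot i]aut_oneE root_refl_orbit; last exact: weyl_one.
by rewrite mul1g invg1 mulg1.
Qed.

Lemma coroot_act w b : weyl w -> root b -> coroot (w b) = coact w (coroot b).
Proof.
move=> ww [v [i [wv ->]]]; rewrite -aut_mulE coroot_orbit; last exact: weyl_mul.
by rewrite coactM coroot_orbit.
Qed.
Lemma root_refl_act w b : weyl w -> root b -> root_refl (w b) = (w * root_refl b * w^-1)%g.
Proof.
move=> ww [v [i [wv ->]]]; rewrite -aut_mulE root_refl_orbit; last exact: weyl_mul.
by rewrite root_refl_orbit // invgM !mulgA.
Qed.
Lemma coroot_opp b : root b -> coroot (- b) = - coroot b.
Proof.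
move=> [v [i [wv ->]]]; rewrite coroot_orbit // -autN -srefl_root -aut_mulE coroot_orbit.
  by rewrite coactM srefl_coroot coactN.
by apply: weyl_mul wv _; exact: weyl_srefl.
Qed.
Lemma root_refl_opp b : root b -> root_refl (- b) = root_refl b.
Proof.
move=> [v [i [wv ->]]]; rewrite root_refl_orbit // -autN -srefl_root -aut_mulE root_refl_orbit.
  by rewrite invgM srefl_inv !mulgA -[(_ * srefl i * srefl i)%g]mulgA sreflK mulg1.
by apply: weyl_mul wv _; exact: weyl_srefl.
Qed.
Lemma coroot_root b : root b -> << coroot b, b >> = 2.
Proof. by move=> [v [i [wv ->]]]; rewrite coroot_orbit // bracket_invariant bracket_ii. Qed.
Lemma weyl_root_refl b : root b -> weyl (root_refl b).
Proof.
move=> [v [i [wv ->]]]; rewrite root_refl_orbit //; apply: weyl_mul (weyl_inv wv).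
exact: weyl_mul wv (weyl_srefl i).
Qed.
Lemma root_reflE b x : root b -> root_refl b x = x - << coroot b, x >> *: b.
Proof.
move=> [v [i [wv ->]]]; rewrite root_refl_orbit // !aut_mulE sreflE autB autVK autZ.
by rewrite coroot_orbit // bracket_coact.
Qed.
Lemma root_refl_root b : root b -> root_refl b b = - b.
Proof. by move=> rb; rewrite root_reflE // coroot_root // -[X in X - _]scale1r -scalerBl scaleN1r. Qed.
Lemma root_refl_inv b : root b -> ((root_refl b)^-1 = root_refl b)%g.
Proof.
by move=> [v [i [wv ->]]]; rewrite root_refl_orbit // !invgM invgK srefl_inv mulgA.
Qed.
Lemma root_reflK b : root b -> (root_refl b * root_refl b = 1)%g.
Proof. by move=> rb; rewrite -{1}root_refl_inv // mulVg. Qed.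
Lemma root_reflKx b x : root b -> root_refl b (root_refl b x) = x.
Proof. by move=> rb; rewrite -aut_mulE root_reflK // aut_oneE. Qed.
Lemma coact_root_refl b y : root b -> coact (root_refl b) y = y - << y, b >> *: coroot b.
Proof.
move=> rb; apply: cowt_inj => x; rewrite bracket_coact root_refl_inv // root_reflE //.
by rewrite bracketBr bracketBl bracketZr bracketZl mulrC.
Qed.

Lemma coroot_pos b : pos_root b -> nnY (coroot b).
Proof.
move=> pb; case: (pos_root_root pb) => w [i [ww be]]; rewrite be coroot_orbit //.
case: (simple_orbit_sign i ww) => -[] // nb.
case: (@pos_anti b pb); apply: nnX_pos (root_opp (pos_root_root pb)); rewrite ?be //.
Qed.

(** A root is W-conjugate to a simple root, and in the basis of simple roots the
    latter has a coordinate 1: it is not a proper multiple. *)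
Lemma root_scale b (a : int) : root b -> root (a *: b) -> a = 1 \/ a = -1.
Proof.
move=> [w [j [ww ->]]] [v [k [wv e]]].
have e1 : sroot k = a *: (v^-1 * w)%g (sroot j).
  by rewrite aut_mulE -autZ e autK.
have wg : weyl (v^-1 * w)%g by apply: weyl_mul ww; exact: weyl_inv.
suff [d ad] : exists d, a * d = 1.
  have /eqP : (absz a * absz d = 1)%N by rewrite -abszM ad.
  by rewrite muln_eq1 => /andP[/eqP a1 _]; lia.
have unit_coef c (u : X) : u = \sum_i c i *: sroot i -> sroot k = a *: u -> a * c k = 1.
  move=> -> e2; have /sroot_coef_inj/(_ k) :
    \sum_i (a * c i) *: sroot i = \sum_i (i == k)%:R *: sroot i :> X.
    rewrite (eq_bigr (fun i => a *: (c i *: sroot i))).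
      rewrite -scaler_sumr -e2 (bigD1 k) //= eqxx scale1r big1 ?addr0 // => i /negPf ->.
      by rewrite scale0r.
    by move=> i _; rewrite scalerA.
  by rewrite eqxx.
case: (simple_orbit_sign j wg) => -[[c c0 ec] _].
  by exists (c k); exact: unit_coef ec e1.
exists (- c k); apply: (unit_coef (fun i => - c i) _ _ e1); rewrite -[LHS]opprK ec -sumrN.
by apply: eq_bigr => i _; rewrite scaleNr.
Qed.

(** The reflection s_i only changes the coordinate along alpha_i. *)
Lemma srefl_pos i b : pos_root b -> b <> sroot i -> pos_root (srefl i b).
Proof.
move=> pb bi; have rs : root (srefl i b) by apply: root_act (pos_root_root pb); exact: weyl_srefl.
case: (root_sign rs) => // /pos_nnX [d d0 ed]; have [c c0 ec] := pos_nnX pb.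
exfalso; set q := << scoroot i, b >> in ed *.
have H : (fun k => c k - q * (k == i)%:R) =1 (fun k => - d k).
  apply: sroot_coef_inj; transitivity (srefl i b).
    rewrite sreflE -/q (eq_bigr _ (fun k _ => scalerBl _ _ _)) sumrB -ec; congr (_ - _).
    rewrite (bigD1 i) //= eqxx mulr1 big1 ?addr0 // => k /negPf ->.
    by rewrite mulr0 scale0r.
  by rewrite -[LHS]opprK ed -sumrN; apply: eq_bigr => k _; rewrite scaleNr.
have ck k : k != i -> c k = 0.
  move=> /negPf ki; apply/eqP; rewrite eq_le c0 andbT; have := H k.
  by rewrite ki mulr0 subr0 => ->; rewrite oppr_le0.
have eb : b = c i *: sroot i.
  rewrite ec (bigD1 i) //= big1 ?addr0 // => k /ck ->; exact: scale0r.
have : root (c i *: sroot i) by rewrite -eb; exact: pos_root_root.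
case/(root_scale (root_simple i)) => e; rewrite e in eb.
  by rewrite scale1r in eb.
by have := c0 i; rewrite e.
Qed.

End Roots.

(** * Inversions *)

Section Inversions.
Variable D : root_datum.
Local Notation I := (idx D).
Local Notation X := (wt D).
Local Notation Y := (cowt D).
Implicit Types (x u b : X) (y l m : Y) (w v g : aut X) (i j k : I).

Lemma sreflKx i x : srefl i (srefl i x) = x.
Proof. by rewrite -aut_mulE sreflK aut_oneE. Qed.

(** Inv(w s_i) is contained in the union of alpha_i and s_i(Inv(w)). *)
Lemma finite_inversions w : weyl w -> finite_set (inversions w).
Proof.
move=> /weylP [s ->]; elim/last_ind: s => [|s i IH].
  apply: (@sub_finite_set _ _ set0) => // b [pb]; rewrite /= /neg_root /= aut_oneE => nb.
  exact: pos_anti pb nb.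
apply: (@sub_finite_set _ _ ([set sroot i] `|` srefl i @` inversions (wprod s))%classic).
  move=> b [pb]; rewrite /= /neg_root /= wprod_rcons aut_mulE => nb.
  have [->|bi] := pselect (b = sroot i); [by left | right].
  by exists (srefl i b); rewrite ?sreflKx //; split=> //; exact: srefl_pos.
by rewrite finite_setU; split; [exact: finite_set1 | exact: finite_image].
Qed.

Definition inv_fset w : {fset X} := fset_set (inversions w).

Lemma inv_fsetP w b : weyl w -> reflect (pos_root b /\ pos_root (- w b)) (b \in inv_fset w).
Proof.
move=> ww; rewrite in_fset_set; last exact: finite_inversions.
by apply: (iffP idP); rewrite inE.
Qed.

Section Sums.
Variables (V : zmodType) (F : X -> V).

Lemma sum_inv_left w i : weyl w -> pos_root ((w^-1)%g (sroot i)) ->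
  \sum_(b <- inv_fset (srefl i * w)%g) F b
  = F ((w^-1)%g (sroot i)) + \sum_(b <- inv_fset w) F b.
Proof.
move=> ww pb; have wsw : weyl (srefl i * w)%g by apply: weyl_mul ww; exact: weyl_srefl.
transitivity (\sum_(b <- (w^-1)%g (sroot i) :: inv_fset w) F b); last by rewrite big_cons.
apply: perm_big; apply: uniq_perm; first exact: fset_uniq.
  rewrite /= fset_uniq andbT; apply/negP => /inv_fsetP -/(_ ww) [_].
  by rewrite autVK => /(pos_anti (pos_simple i)).
move=> b; apply/idP/idP.
  case/inv_fsetP=> // pb0; rewrite aut_mulE inE => nb.
  have [e|ne] := eqVneq (w b) (sroot i); first by rewrite -e autK eqxx.
  apply/orP; right; apply/inv_fsetP => //; split=> //.
  rewrite -[X in pos_root X](sreflKx i); apply: srefl_pos; first by rewrite autN.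
  rewrite autN => e; move/eqP: ne; apply; apply: (@aut_inj _ (srefl i)).
  by rewrite srefl_root -e opprK.
rewrite inE => /orP[/eqP ->|/inv_fsetP -/(_ ww)[pb0 nb]]; apply/inv_fsetP => //.
  by split=> //; rewrite aut_mulE autVK srefl_root opprK; exact: pos_simple.
split=> //; rewrite aut_mulE -autN; apply: srefl_pos => // e.
have : pos_root (- (w^-1)%g (sroot i)) by rewrite -e autN autK opprK.
exact: pos_anti pb.
Qed.

Lemma sum_inv_right w i : weyl w -> pos_root (w (sroot i)) ->
  \sum_(b <- inv_fset (w * srefl i)%g) F b
  = F (sroot i) + \sum_(b <- inv_fset w) F (srefl i b).
Proof.
move=> ww pb; have wws : weyl (w * srefl i)%g by apply: weyl_mul ww _; exact: weyl_srefl.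
transitivity (\sum_(b <- sroot i :: [seq srefl i b | b <- inv_fset w]) F b).
  2: by rewrite big_cons big_map.
apply: perm_big; apply: uniq_perm; first exact: fset_uniq.
  rewrite /= map_inj_uniq ?fset_uniq ?andbT; last exact: aut_inj.
  apply/mapP => -[b /inv_fsetP -/(_ ww)[pb0 nb] e].
  by move: nb; rewrite -[b](sreflKx i) -e srefl_root autN opprK => nb;
     move: pb0; rewrite -[b](sreflKx i) -e srefl_root => /(pos_anti (pos_simple i)).
move=> b; apply/idP/idP.
  case/inv_fsetP=> // pb0; rewrite aut_mulE inE => nb.
  have [//|/eqP ne /=] := eqVneq b (sroot i).
  apply/mapP; exists (srefl i b); rewrite ?sreflKx //; apply/inv_fsetP=> //.
  by split=> //; exact: srefl_pos.
rewrite inE => /orP[/eqP ->|/mapP[c /inv_fsetP -/(_ ww)[pc nc] ->]]; apply/inv_fsetP => //.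
  split; first exact: pos_simple.
  by rewrite aut_mulE srefl_root autN opprK.
split; last by rewrite aut_mulE sreflKx.
apply: srefl_pos => // e; rewrite e in nc; exact: pos_anti pb nc.
Qed.

(** The map c |-> - s_b(c) is an involution of Inv(s_b); it pairs the terms of the
    sums below. *)
Lemma sum_inv_refl b : root b ->
  \sum_(c <- inv_fset (root_refl b)) F c = \sum_(c <- inv_fset (root_refl b)) F (- root_refl b c).
Proof.
move=> rb; have wr := weyl_root_refl rb.
rewrite -(big_map (fun c => - root_refl b c) xpredT F); apply: perm_big.
have injr : injective (fun c => - root_refl b c) by move=> c d /oppr_inj /aut_inj.
have stab c : c \in inv_fset (root_refl b) -> - root_refl b c \in inv_fset (root_refl b).
  case/inv_fsetP => // pc nc; apply/inv_fsetP => //; split=> //.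
  by rewrite autN root_reflKx // opprK.
apply: uniq_perm; first exact: fset_uniq.
  by rewrite map_inj_uniq // fset_uniq.
move=> c; apply/idP/mapP => [/stab cJ|[d /stab dJ ->]//].
by exists (- root_refl b c) => //; rewrite autN root_reflKx // opprK.
Qed.

End Sums.

Lemma sum_inv_inv (V : zmodType) (F : X -> V) w : weyl w ->
  \sum_(b <- inv_fset (w^-1)%g) F b = \sum_(b <- inv_fset w) F (- w b).
Proof.
move=> ww; rewrite -(big_map (fun c => - w c) xpredT F); apply: perm_big.
have ww' := weyl_inv ww.
apply: uniq_perm; first exact: fset_uniq.
  by rewrite map_inj_uniq ?fset_uniq // => c d /oppr_inj /aut_inj.
move=> c; apply/idP/mapP => [/inv_fsetP -/(_ ww') [pc nc]|[d /inv_fsetP -/(_ ww) [pd nd] ->]].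
  by exists (- (w^-1)%g c); [apply/inv_fsetP=> //; split=> // | ];
    rewrite autN autVK opprK.
by apply/inv_fsetP => //; split=> //; rewrite autN autK opprK.
Qed.

Lemma sum_subfset (V : zmodType) (F : X -> V) (A B : {fset X}) :
  {subset A <= B} -> \sum_(b <- A) F b = \sum_(b <- B | b \in A) F b.
Proof.
move=> AB; rewrite -[RHS]big_filter; apply: perm_big; apply: uniq_perm.
- exact: fset_uniq.
- by rewrite filter_uniq // fset_uniq.
by move=> b; rewrite mem_filter; case bA: (b \in A) => //=; rewrite AB.
Qed.

Lemma inv_fset1 : inv_fset 1%g = fset0.
Proof.
apply/fsetP => b; rewrite inE; apply/negP => /inv_fsetP -/(_ (weyl_one D)) [pb].
by rewrite aut_oneE; exact: pos_anti.
Qed.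

Lemma inv_srefl_mul w i : weyl w -> ~ pos_root ((w^-1)%g (sroot i)) ->
  pos_root (((srefl i * w)^-1)%g (sroot i)).
Proof.
move=> ww np; rewrite invgM srefl_inv aut_mulE srefl_root autN; apply/posN => //.
by apply: root_act (root_simple i); exact: weyl_inv.
Qed.

Lemma mul_srefl_pos w i : weyl w -> ~ pos_root (w (sroot i)) ->
  pos_root ((w * srefl i)%g (sroot i)).
Proof.
move=> ww np; rewrite aut_mulE srefl_root autN; apply/posN => //.
exact: root_act (root_simple i).
Qed.

(** * Dominance and the Tits cone *)

Lemma nnY_anti l : nnY l -> nnY (- l) -> l = 0.
Proof.
move=> [c c0 ->] [d d0 e]; rewrite big1 // => i _.
suff -> : c i = 0 by rewrite scale0r.
have : c i + d i = 0.
  apply: (@scoroot_indep D (fun i => c i + d i)).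
  by rewrite (eq_bigr _ (fun i _ => scalerDl _ _ _)) big_split /= -e subrr.
by have := c0 i; have := d0 i; lia.
Qed.

Lemma dominant_pos m b : dominant m -> pos_root b -> 0 <= << m, b >>.
Proof.
move=> dm /pos_nnX [c c0 ->]; rewrite bracket_sumr; apply: sumr_ge0 => i _.
by rewrite bracketZr mulr_ge0.
Qed.

Lemma dominant_neg m b : dominant m -> pos_root (- b) -> << m, b >> <= 0.
Proof. by move=> dm /(dominant_pos dm); rewrite bracketNr oppr_ge0. Qed.

(** Along a reduced word, m - w m grows by multiples of positive coroots. *)
Lemma dominant_sub m w : dominant m -> weyl w -> nnY (m - coact w m).
Proof.
move=> dm /exists_reduced [s -> rs].
elim/last_ind: s rs => [|s i IH] rs.
  by rewrite coact1 subrr; exists (fun=> 0) => //; rewrite big1 // => i _; rewrite scale0r.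
have redS : reduced s.
  move=> t e; have := rs (rcons t i); rewrite !wprod_rcons e => /(_ erefl).
  by rewrite !size_rcons.
have P : nnY (coact (wprod s) (scoroot i)).
  by apply: orbit_pos_Y => // t e; have := rs t e; rewrite size_rcons => /ltnW.
rewrite wprod_rcons coactM coact_srefl coactB coactZ opprB addrA addrAC.
by apply: nncombD; [exact: IH | exact: nncombZ].
Qed.

(** Each of m and m' is obtained from the other by subtracting a nonnegative
    combination of simple coroots. *)
Lemma dominant_unique m m' w : dominant m -> dominant m' -> weyl w -> m' = coact w m -> m' = m.
Proof.
move=> dm dm' ww e; apply/eqP; rewrite -subr_eq0; apply/eqP.
apply: nnY_anti; last by rewrite opprB e; exact: dominant_sub.
have -> : m = coact (w^-1)%g m' by rewrite e coactK.
by apply: dominant_sub => //; exact: weyl_inv.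
Qed.

Lemma dom_reprE w m : weyl w -> dominant m -> dom_repr (coact w m) = m.
Proof.
move=> ww dm; rewrite /dom_repr; apply: xget_unique.
  by split=> //; exists (w^-1)%g; [exact: weyl_inv | rewrite coactK].
move=> m' [dm' [v wv e]]; apply: (@dominant_unique _ _ (v * w)%g) => //.
  exact: weyl_mul.
by rewrite coactM.
Qed.

Lemma dom_repr_act w l : weyl w -> tits l -> dom_repr (coact w l) = dom_repr l.
Proof.
move=> ww [v [m [wv dm ->]]]; rewrite -coactM !dom_reprE //.
exact: weyl_mul.
Qed.

Lemma tits_act w l : weyl w -> tits l -> tits (coact w l).
Proof.
move=> ww [v [m [wv dm ->]]]; exists (w * v)%g, m; split=> //; first exact: weyl_mul.
by rewrite coactM.
Qed.

Definition neg_pairing l : set X := [set b | pos_root b /\ << l, b >> < 0]%classic.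

Lemma tits_finite l : tits l -> finite_set (neg_pairing l).
Proof.
move=> [w [m [ww dm ->]]].
apply: sub_finite_set (finite_inversions (weyl_inv ww)) => b [pb].
rewrite bracket_coact => lt0; split=> //=; rewrite /neg_root /=.
apply/posN; first by apply: root_act (pos_root_root pb); exact: weyl_inv.
by move=> /(dominant_pos dm); rewrite leNgt lt0.
Qed.

(** The measure argument behind both reductions by simple reflections: s_i maps B
    into A, away from alpha_i. *)
Lemma srefl_remove_card (A B : set X) i : finite_set A -> A (sroot i) ->
  (forall b, B b -> pos_root b /\ b <> sroot i) -> (forall b, B b -> A (srefl i b)) ->
  finite_set B /\ (#|` fset_set B | < #|` fset_set A |)%N.
Proof.
move=> fA Ai Bpos BA.
have sub : (B `<=` srefl i @` (A `\ sroot i))%classic.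
  move=> b Bb; have [pb bi] := Bpos b Bb.
  exists (srefl i b); rewrite ?sreflKx //; split; first exact: BA.
  move=> e; apply: (pos_anti (pos_simple i)).
  by rewrite -srefl_root -e sreflKx.
have fi : finite_set (srefl i @` (A `\ sroot i))%classic.
  by apply: finite_image; exact: finite_setD.
have fB : finite_set B := sub_finite_set sub fi.
split=> //; have iA : sroot i \in fset_set A by rewrite in_fset_set // inE.
rewrite [X in (_ < X)%N](cardfsD1 (sroot i)) iA add1n ltnS.
have cB (C : {fset X}) : #|` C | = #|` [fset srefl i b | b in C]%fset |.
  by apply/esym/card_imfset; exact: aut_inj.
rewrite [X in (_ <= X)%N]cB; apply: fsubset_leq_card; apply/fsubsetP => b.
rewrite in_fset_set // inE => /sub [c [lc ci] <-].
apply/imfsetP; exists c => //=; rewrite !inE; apply/andP; split; first exact/eqP.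
by rewrite in_fset_set // inE.
Qed.

Lemma neg_pairing_card l i : finite_set (neg_pairing l) -> << l, sroot i >> < 0 ->
  finite_set (neg_pairing (coact (srefl i) l)) /\
  (#|` fset_set (neg_pairing (coact (srefl i) l)) | < #|` fset_set (neg_pairing l) |)%N.
Proof.
move=> fl lt0.
have ne b : neg_pairing (coact (srefl i) l) b -> pos_root b /\ b <> sroot i.
  move=> [pb]; rewrite bracket_coact srefl_inv => lb; split=> // e.
  by move: lb; rewrite e srefl_root bracketNr oppr_lt0 ltNge ltW.
apply: (srefl_remove_card fl _ ne); first by split=> //; exact: pos_simple.
move=> b nb; have [pb bi] := ne b nb; case: nb => _.
by rewrite bracket_coact srefl_inv => lb; split=> //; exact: srefl_pos.
Qed.

(** As long as l is not dominant, some s_i decreases the number of positive roots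
    that are negative on l. *)
Lemma finite_tits l : finite_set (neg_pairing l) -> tits l.
Proof.
have [n] := ubnP #|` fset_set (neg_pairing l)|; elim: n => // n IH in l *; rewrite ltnS => ln fl.
have [[i lt0]|nex] := pselect (exists i, << l, sroot i >> < 0).
  have [fl' lt] := neg_pairing_card fl lt0.
  have tl : tits (coact (srefl i) l) by apply: IH => //; exact: leq_trans lt ln.
  have -> : l = coact (srefl i) (coact (srefl i) l) by rewrite -coactM sreflK coact1.
  by apply: tits_act => //; exact: weyl_srefl.
exists 1%g, l; split; [exact: weyl_one | | by rewrite coact1].
by move=> i /=; rewrite leNgt; apply/negP => lt0; apply: nex; exists i.
Qed.

(** A positive root which is negative at a point of the segment from l to s_b(l) is
    negative at one of the ends, and there are finitely many such roots. *)
Lemma tits_segment l b (m : int) : root b -> tits l -> 0 <= m -> m <= - << l, b >> ->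
  tits (l + m *: coroot b).
Proof.
move=> rb tl m0 mb; apply: finite_tits.
have tl' : tits (coact (root_refl b) l) by apply: tits_act tl; exact: weyl_root_refl.
apply: (@sub_finite_set _ _ (neg_pairing l `|` neg_pairing (coact (root_refl b) l))%classic).
  move=> a [pa]; rewrite bracketDl bracketZl => lt0.
  have [ge0|] := lerP 0 << l, a >>; last by left.
  right; split=> //; rewrite coact_root_refl // bracketBl bracketZl.
  set p := << l, a >> in lt0 ge0 *; set q := << coroot b, a >> in lt0 *.
  set r := << l, b >> in mb *.
  have q0 : q <= 0 by nia.
  have : (- r - m) * q <= 0 by rewrite mulr_ge0_le0 // subr_ge0.
  by rewrite mulrBl; lia.
by rewrite finite_setU; split; exact: tits_finite.
Qed.

(** * Heights of coweights *)
Section Height.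
Variable L : I -> wtQ D.
Hypothesis hL : fundamental_weights L.

Lemma bracketQDl l m (v : wtQ D) : bracketQ (l + m) v = bracketQ l v + bracketQ m v.
Proof.
rewrite /bracketQ -big_split; apply: eq_bigr => k _.
by rewrite bracketDl rmorphD mulrDr.
Qed.
Lemma bracketQZl a l (v : wtQ D) : bracketQ (a *: l) v = a%:~R * bracketQ l v.
Proof.
rewrite /bracketQ mulr_sumr; apply: eq_bigr => k _.
by rewrite bracketZl rmorphM /= mulrCA.
Qed.
Lemma bracketQ_sumr l (F : I -> wtQ D) : bracketQ l (\sum_i F i) = \sum_i bracketQ l (F i).
Proof.
rewrite /bracketQ exchange_big; apply: eq_bigr => k _ /=.
by rewrite summxE mulr_suml.
Qed.

Lemma htD l m : ht L (l + m) = ht L l + ht L m. Proof. exact: bracketQDl. Qed.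
Lemma htZ a l : ht L (a *: l) = a%:~R * ht L l. Proof. exact: bracketQZl. Qed.
Lemma htB l m : ht L (l - m) = ht L l - ht L m.
Proof. by rewrite htD -scaleN1r htZ mulN1r. Qed.
Lemma ht_scoroot i : ht L (scoroot i) = 1.
Proof.
rewrite /ht bracketQ_sumr (bigD1 i) //= hL eqxx big1 ?addr0 // => j ji.
by rewrite hL eq_sym (negPf ji).
Qed.

(** Equivalently, rho - w^-1(rho) is the sum of the inversions of w. *)
Lemma ht_act w l : weyl w ->
  ht L l - ht L (coact w l) = (\sum_(b <- inv_fset w) << l, b >>)%:~R.
Proof.
move=> /weylP [s ->]; elim/last_ind: s l => [|s i IH] l.
  by rewrite coact1 subrr inv_fset1 big_nil.
set v := wprod s; have wv : weyl v := weyl_wprod s.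
rewrite wprod_rcons coactM.
have e1 : ht L l = ht L (coact (srefl i) l) + (<< l, sroot i >>)%:~R.
  by rewrite coact_srefl htB htZ ht_scoroot mulr1 subrK.
rewrite e1 addrAC IH -/v -rmorphD; congr (_%:~R).
have inner b : << coact (srefl i) l, b >> = << l, srefl i b >>.
  by rewrite bracket_coact srefl_inv.
under eq_bigr => b _ do rewrite inner.
have [p|np] := pselect (pos_root (v (sroot i))).
  by rewrite sum_inv_right // addrC.
have wvs : weyl (v * srefl i)%g by apply: weyl_mul wv _; exact: weyl_srefl.
have := sum_inv_right (fun b => << l, srefl i b >>) wvs (mul_srefl_pos wv np).
rewrite -mulgA sreflK mulg1 => ->; rewrite srefl_root bracketNr addrAC addNr add0r.
by apply: eq_bigr => b _; rewrite sreflKx.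
Qed.

(* The previous formula for theta^vee, which s_theta changes into its opposite. *)
Lemma ht_coroot b : root b ->
  2 * ht L (coroot b) = (\sum_(c <- inv_fset (root_refl b)) << coroot b, c >>)%:~R.
Proof.
move=> rb; rewrite -ht_act; last exact: weyl_root_refl.
rewrite coact_root_refl // coroot_root // htB htZ opprB addrC subrK.
by [].
Qed.

End Height.
End Inversions.

(** * Affinized roots and their reflections *)

Section Affine.
Variable D : root_datum.
Local Notation I := (idx D).
Local Notation X := (wt D).
Local Notation Y := (cowt D).
Local Notation WA := (Y * aut X)%type.
Local Notation aff := (X * int)%type.
Implicit Types (u b : X) (l m : Y) (w v g : aut X) (i j k : I) (x y z : WA) (a c : aff).

Lemma wa_mulA x y z : wa_mul (wa_mul x y) z = wa_mul x (wa_mul y z).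
Proof. by rewrite /wa_mul /= coactD coactM addrA mulgA. Qed.

Lemma wa_act_mul x y a : wa_act (wa_mul x y) a = wa_act x (wa_act y a).
Proof.
rewrite /wa_act /wa_mul /= aut_mulE bracketDl bracket_invariant.
by congr (_, _); rewrite addrA addrAC.
Qed.

Definition aneg a : aff := (- a.1, - a.2).

Lemma anegK a : aneg (aneg a) = a.
Proof. by case: a => b n; rewrite /aneg /= !opprK. Qed.
Lemma wa_act_neg x a : wa_act x (aneg a) = aneg (wa_act x a).
Proof. by rewrite /wa_act /aneg /= autN bracketNr opprD. Qed.

Lemma wa_act_root x a : weyl x.2 -> root a.1 -> root (wa_act x a).1.
Proof. exact: root_act. Qed.

(** Defined for affinized roots of either sign: as s_a = s_(-a), this spares the case
    distinctions of b[n]. *)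
Definition arefl a : WA := (a.2 *: coroot a.1, root_refl a.1).

Lemma arefl_act c a : root c.1 -> let q := << coroot c.1, a.1 >> in
  wa_act (arefl c) a = (a.1 - q *: c.1, a.2 - q * c.2).
Proof.
move=> rc q; rewrite /wa_act /arefl /= root_reflE //; congr (_, _).
rewrite bracketZl bracketBr bracketZr coroot_root // -/q.
by ring.
Qed.

Lemma arefl_self c : root c.1 -> wa_act (arefl c) c = aneg c.
Proof.
move=> rc; rewrite arefl_act // coroot_root // /aneg; case: c rc => c n /= _.
by congr (_, _); [rewrite -[X in X - _]scale1r -scalerBl -scaleN1r | ring].
Qed.

Lemma arefl_actK c : root c.1 -> involutive (wa_act (arefl c)).
Proof.
move=> rc [b n]; rewrite !arefl_act //= bracketBr bracketZr coroot_root //.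
set q := << _, _ >>; have -> : q - q * 2 = - q by ring.
by rewrite scaleNr mulNr !opprK !subrK.
Qed.

Lemma arefl_conj x a : weyl x.2 -> root a.1 ->
  wa_mul x (arefl a) = wa_mul (arefl (wa_act x a)) x.
Proof.
move=> wx ra; rewrite /wa_mul /arefl /wa_act /=; congr (_, _).
  rewrite coactZ coroot_act // coact_root_refl; last exact: root_act.
  by rewrite coroot_act // scalerDl [RHS]addrC [X in _ = _ + X]addrC addrA subrK.
by rewrite root_refl_act // mulgVK.
Qed.

Lemma areflK x a : root a.1 -> wa_mul (wa_mul x (arefl a)) (arefl a) = x.
Proof.
move=> ra; case: x => l w; rewrite wa_mulA /wa_mul /arefl /= root_reflK // mulg1.
congr (_, _); rewrite coactZ coact_root_refl // coroot_root //.
rewrite -[X in _ *: (X - _)]scale1r -scalerBl scaleN1r scalerN subrr coact0 addr0.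
by [].
Qed.

Lemma arefl_refl x c a : root c.1 -> root a.1 ->
  wa_mul (wa_mul (wa_mul x (arefl c)) (arefl (wa_act (arefl c) a))) (arefl c)
  = wa_mul x (arefl a).
Proof.
move=> rc ra; rewrite !wa_mulA -arefl_conj //; last exact: weyl_root_refl.
by rewrite -!wa_mulA areflK.
Qed.

Lemma arefl_neg a : root a.1 -> arefl (aneg a) = arefl a.
Proof. by move=> ra; rewrite /arefl /= coroot_opp // root_refl_opp // scalerN scaleNr opprK. Qed.

Lemma pos_aroot_root a : pos_aroot a -> root a.1. Proof. by case. Qed.

Lemma aroot_sign a : root a.1 -> pos_aroot a \/ pos_aroot (aneg a).
Proof.
move=> ra; case: (ltrgt0P a.2) => a2.
- by left; split=> //; left.
- by right; split; [exact: root_opp | left; rewrite oppr_gt0].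
case: (root_sign ra) => H; first by left; split=> //; right.
by right; split; [exact: root_opp | right; split=> //=; rewrite a2 oppr0].
Qed.

Lemma aroot_anti a : pos_aroot a -> pos_aroot (aneg a) -> False.
Proof.
move=> [_ H] [_ /= G]; case: H G => [a0|[a0 p]] [b0|[b0 q]]; try lia.
exact: pos_anti p q.
Qed.

Lemma aposN a : root a.1 -> ~ pos_aroot a <-> pos_aroot (aneg a).
Proof.
move=> ra; split=> [np|nb pb]; last exact: aroot_anti pb nb.
by case: (aroot_sign ra).
Qed.

Lemma bracket_root_pos b (n : int) : root b ->
  pos_aroot (bracket_root b n) /\ aroot_refl b n = arefl (bracket_root b n).
Proof.
move=> rb; rewrite /bracket_root.
have P (c : X) (k : int) : pos_root c -> pos_aroot (pos_bracket_root c k) /\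
    aroot_refl c k = arefl (pos_bracket_root c k).
  move=> pc; have rc := pos_root_root pc.
  rewrite /pos_bracket_root /sgn /aroot_refl /arefl.
  have [k0|k0] := lerP 0 k.
    rewrite scale1r ger0_norm //=; split=> //; split=> //=.
    by move: k0; rewrite le_eqVlt => /orP[/eqP <-|]; [right|left].
  rewrite scaleN1r ltr0_norm //= coroot_opp // root_refl_opp // scalerN scaleNr opprK; split=> //.
  by split=> /=; [exact: root_opp | left; rewrite oppr_gt0].
case: ifPn => [|/negP]; rewrite inE; first exact: P.
move=> /posN -/(_ rb) nb; have [H1 H2] := P _ (- n) nb; split=> //.
by rewrite -H2 /aroot_refl coroot_opp // root_refl_opp // scalerN scaleNr opprK.
Qed.

(** The positive affinized roots are exactly the b[n], whence a description of the
    generating relations by arbitrary positive affinized roots. *)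
Lemma bruhat_stepP x y : bruhat_step x y <->
  [/\ wa_plus x, wa_plus y & exists a, [/\ pos_aroot a, pos_aroot (wa_act x a) & y = wa_mul x (arefl a)]].
Proof.
split=> [[b [n [rb px py e pa]]]|[px py [[b n] [pa pxa e]]]].
  split=> //; exists (bracket_root b n); have [p1 p2] := bracket_root_pos n rb.
  by rewrite -p2.
have rb : root b := pos_aroot_root pa.
have E (c : X) (k : int) : pos_aroot (c, k) -> pos_root c -> bracket_root c k = (c, k).
  move=> [_ H] pc; rewrite /bracket_root mem_set // /pos_bracket_root /sgn.
  have k0 : 0 <= k by case: H => /= [/ltW//|[->]].
  by rewrite k0 scale1r ger0_norm.
case: (root_sign rb) => sb.
  by exists b, n; split=> //; rewrite ?E // ?e.
have n0 : 0 < n by case: pa => _ /= [//|[_ /pos_anti /(_ sb)]].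
have Eb : bracket_root (- b) (- n) = (b, n).
  by rewrite /bracket_root mem_set // /pos_bracket_root /sgn oppr_ge0 leNgt n0 /= scaleN1r
    opprK normrN gtr0_norm.
exists (- b), (- n); split=> //; rewrite ?Eb //; first exact: root_opp.
by rewrite e /aroot_refl /arefl /= coroot_opp // root_refl_opp // scalerN scaleNr opprK.
Qed.

(** If y(c) is negative, the coweight of y s_c lies between the coweight l of y and
    its image under the reflection along y(c): descending from an element of the
    semigroup never leaves it. *)
Lemma step_down y c : wa_plus y -> pos_aroot c -> pos_aroot (aneg (wa_act y c)) ->
  bruhat_step (wa_mul y (arefl c)) y.
Proof.
move=> py pc nc; have [ty wy] := py; have rc := pos_aroot_root pc.
have wr := weyl_root_refl rc.
apply/bruhat_stepP; split=> //.
  split; last exact: weyl_mul.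
  rewrite /= coactZ -coroot_act //; apply: tits_segment => //; first exact: root_act.
    by case: pc => _ [/ltW//|[->]].
  by case: nc => _ /= [|[]]; lia.
exists c; split=> //; last by rewrite areflK.
by rewrite wa_act_mul arefl_self // wa_act_neg.
Qed.

(** * Multiplication by a simple reflection *)

Definition rmul i x : WA := (x.1, x.2 * srefl i)%g.
Definition lmul i x : WA := (coact (srefl i) x.1, srefl i * x.2)%g.

Lemma rmulE i x : rmul i x = wa_mul x (arefl (sroot i, 0)).
Proof. by rewrite /rmul /wa_mul /arefl /= scale0r coact0 addr0 root_refl_simple. Qed.
Lemma lmulE i x : lmul i x = wa_mul (arefl (sroot i, 0)) x.
Proof. by rewrite /lmul /wa_mul /arefl /= scale0r add0r root_refl_simple. Qed.
Lemma rmulK i : involutive (rmul i).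
Proof. by case=> l w; rewrite /rmul /= -mulgA sreflK mulg1. Qed.
Lemma lmulK i : involutive (lmul i).
Proof. by case=> l w; rewrite /lmul /= mulgA sreflK mul1g -coactM sreflK coact1. Qed.
Lemma rmul_plus i x : wa_plus x -> wa_plus (rmul i x).
Proof. by move=> [t w]; split=> //=; apply: weyl_mul w _; exact: weyl_srefl. Qed.
Lemma lmul_plus i x : wa_plus x -> wa_plus (lmul i x).
Proof.
move=> [t w]; split=> /=; last by apply: weyl_mul w; exact: weyl_srefl.
by apply: tits_act t; exact: weyl_srefl.
Qed.

Lemma pos_aroot_srefl i a : pos_aroot a -> a <> (sroot i, 0) -> pos_aroot (srefl i a.1, a.2).
Proof.
move=> [ra H] ne; split; first by apply: root_act ra; exact: weyl_srefl.
case: H => [a0|[a0 pa]]; [by left | right; split=> //=].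
by apply: srefl_pos => // e; apply: ne; case: a e a0 {ra pa} => ? ? /= -> ->.
Qed.

Lemma simple_arefl_act i a : wa_act (arefl (sroot i, 0)) a = (srefl i a.1, a.2).
Proof. by rewrite /wa_act /arefl /= scale0r bracket0l addr0 root_refl_simple. Qed.

(** A simple reflection permutes the positive affinized roots other than its own,
    and x s_i maps s_i(a) to x(a). *)
Lemma step_rmul i x y : bruhat_step x y -> y = rmul i x \/ bruhat_step (rmul i x) (rmul i y).
Proof.
move=> /bruhat_stepP [px py [a [pa pxa e]]].
have [ea|ne] := pselect (a = (sroot i, 0)); first by left; rewrite rmulE e ea.
right; apply/bruhat_stepP; split; [exact: rmul_plus | exact: rmul_plus |].
have rs := root_simple i.
exists (wa_act (arefl (sroot i, 0)) a); split.
- by rewrite simple_arefl_act; exact: pos_aroot_srefl.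
- rewrite rmulE wa_act_mul -[wa_act (arefl _) (wa_act _ _)]wa_act_mul.
  have -> : wa_act (wa_mul (arefl (sroot i, 0)) (arefl (sroot i, 0))) a = a => //.
  by rewrite wa_act_mul !simple_arefl_act /= sreflKx; case: (a).
- rewrite !rmulE e -(@arefl_refl x (sroot i, 0) a rs (pos_aroot_root pa)).
  by rewrite areflK.
Qed.

(** Here it is x(a), and not a, which is moved by s_i. *)
Lemma step_lmul i x y : bruhat_step x y -> y = lmul i x \/ bruhat_step (lmul i x) (lmul i y).
Proof.
move=> /bruhat_stepP [px py [a [pa pxa e]]].
have [ea|ne] := pselect (wa_act x a = (sroot i, 0)).
  left; rewrite lmulE -ea -arefl_conj //; [by case: px | exact: pos_aroot_root].
right; apply/bruhat_stepP; split; [exact: lmul_plus | exact: lmul_plus |].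
exists a; split=> //; last by rewrite !lmulE e wa_mulA.
by rewrite lmulE wa_act_mul simple_arefl_act; exact: pos_aroot_srefl.
Qed.

(** * Simple reflections and the length *)

Section Length.
Variable L : I -> wtQ D.

(** The part of the length that does not come from the height. *)
Definition fin_length x : int := \sum_(b <- inv_fset (x.2^-1)%g) sgn << x.1, b >>.

Lemma card_fset_count (T : choiceType) (A B : {fset T}) (P : pred T) :
  (forall t, (t \in B) = (t \in A) && P t) -> #|` B | = \sum_(t <- A) (P t : nat).
Proof.
move=> H; have -> : #|` B | = size [seq t <- A | P t].
  apply: perm_size; apply: uniq_perm => [||t]; rewrite ?fset_uniq ?filter_uniq ?fset_uniq //.
  by rewrite mem_filter andbC H.
by rewrite size_filter -sum1_count big_mkcond.
Qed.

Lemma alengthE x : weyl x.2 ->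
  alength L x = 2 * ht L (dom_repr x.1) + (fin_length x)%:~R.
Proof.
move=> wx; have wx' := weyl_inv wx; have fx := finite_inversions wx'.
rewrite /alength -addrA; congr (_ + _).
have f1 (P : pred X) : #|` fset_set [set b | inversions (x.2^-1)%g b /\ P b]%classic |
    = \sum_(b <- inv_fset (x.2^-1)%g) (P b : nat).
  apply: card_fset_count => b; rewrite in_fset_set; last first.
    by apply: sub_finite_set fx => b' [].
  by apply/idP/andP; rewrite !(inE, in_fset_set) //= => -[].
rewrite (f1 (fun b => 0 <= << x.1, b >>)) (f1 (fun b => << x.1, b >> < 0)).
rewrite !natr_sum /fin_length rmorph_sum -sumrB; apply: eq_bigr => b _.
by rewrite /sgn /=; case: ltrP => _ /=; rewrite ?subr0 ?sub0r ?rmorphN.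
Qed.

(* Whether x < x s_i and x < s_i x; the affinized root in [lasc] is the image of
   alpha_i under x^-1. *)
Definition rasc i x := pos_aroot (wa_act x (sroot i, 0)).
Definition lasc i x := pos_aroot ((x.2^-1)%g (sroot i), - << x.1, sroot i >>).

Lemma sgn_pos (n : int) : 0 <= n -> sgn n = 1. Proof. by rewrite /sgn => ->. Qed.
Lemma sgn_neg (n : int) : n < 0 -> sgn n = -1. Proof. by rewrite /sgn leNgt => ->. Qed.

(* Only the root x.2(alpha_i), up to sign, enters or leaves Inv(x.2^-1). *)
Lemma rasc_up i x : wa_plus x -> rasc i x ->
  bruhat_step x (rmul i x) /\ alength L (rmul i x) = alength L x + 1.
Proof.
move=> px ax; have [tx wx] := px; have pr := rmul_plus i px; have [_ wr] := pr.
split.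
  apply/bruhat_stepP; split=> //; exists (sroot i, 0); split=> //; last by rewrite rmulE.
  by split; [exact: root_simple | right; split=> //; exact: pos_simple].
rewrite !alengthE //= -addrA; congr (_ + _); rewrite -[1]/(1%:~R) -rmorphD; congr (_%:~R).
have [_ /= ax'] := ax; rewrite add0r in ax'; have wx' := weyl_inv wx.
rewrite /fin_length invgM srefl_inv [rmul i x]/= .
have [p|np] := pselect (pos_root (x.2 (sroot i))).
  rewrite sum_inv_left ?invgK // addrC; congr (_ + _); apply: sgn_pos.
  by case: ax' => [/ltW//|[->]].
have lt0 : 0 < << x.1, x.2 (sroot i) >> by case: ax' => [//|[_ p]].
have := @inv_srefl_mul D _ i wx'; rewrite invgK => /(_ np).
rewrite invgM srefl_inv invgK => pn.
have := sum_inv_left (fun b => sgn << x.1, b >>) (w := (srefl i * x.2^-1)%g) (i := i).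
rewrite mulgA sreflK mul1g invgM invgK srefl_inv => -> //; last first.
  by apply: weyl_mul wx'; exact: weyl_srefl.
rewrite aut_mulE srefl_root autN bracketNr sgn_neg ?oppr_lt0 //.
by rewrite addrAC addNr add0r.
Qed.

Lemma rasc_rmul i x : weyl x.2 -> ~ rasc i x -> rasc i (rmul i x).
Proof.
move=> wx; rewrite /rasc => na; rewrite rmulE wa_act_mul arefl_self; last exact: root_simple.
by rewrite wa_act_neg; apply/aposN => //; apply: wa_act_root => //; exact: root_simple.
Qed.

Lemma rmul_dir i x : wa_plus x ->
  (rasc i x /\ (bruhat_step x (rmul i x) /\ alength L (rmul i x) = alength L x + 1)) \/
  (~ rasc i x /\ (bruhat_step (rmul i x) x /\ alength L x = alength L (rmul i x) + 1)).
Proof.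
move=> px; have [a|na] := pselect (rasc i x); [left|right]; split=> //; first exact: rasc_up.
have := rasc_up (rmul_plus i px) (rasc_rmul (proj2 px) na); rewrite rmulK.
by [].
Qed.

(* Only alpha_i enters or leaves Inv(x.2^-1); s_i moves its other elements as it
   moves the coweight, so that their pairings do not change. *)
Lemma lasc_up i x : wa_plus x -> lasc i x ->
  bruhat_step x (lmul i x) /\ alength L (lmul i x) = alength L x + 1.
Proof.
move=> px ax; have [tx wx] := px; have pr := lmul_plus i px; have [_ wr] := pr.
have wx' := weyl_inv wx.
split.
  have aE : wa_act x ((x.2^-1)%g (sroot i), - << x.1, sroot i >>) = (sroot i, 0).
    by rewrite /wa_act /= autVK addNr.
  apply/bruhat_stepP; split=> //; exists ((x.2^-1)%g (sroot i), - << x.1, sroot i >>); split=> //.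
    rewrite aE; split; [exact: root_simple | right; split=> //; exact: pos_simple].
  rewrite arefl_conj ?aE ?lmulE //; exact: pos_aroot_root ax.
rewrite !alengthE //= dom_repr_act //; last exact: weyl_srefl.
rewrite -addrA; congr (_ + _); rewrite -[1]/(1%:~R) -rmorphD; congr (_%:~R).
have [_ /= ax'] := ax.
rewrite /fin_length invgM srefl_inv [lmul i x]/= .
have act b : << coact (srefl i) x.1, b >> = << x.1, srefl i b >>.
  by rewrite bracket_coact srefl_inv.
under eq_bigr => b _ do rewrite act.
have [p|np] := pselect (pos_root ((x.2^-1)%g (sroot i))).
  rewrite sum_inv_right // srefl_root bracketNr addrC; congr (_ + _); last first.
    by apply: sgn_pos; case: ax' => [/ltW|[->]].
  by apply: eq_bigr => b _; rewrite sreflKx.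
have lt0 : 0 < - << x.1, sroot i >> by case: ax' => [//|[_ p]].
have := sum_inv_right (fun b => sgn << x.1, b >>) (w := (x.2^-1 * srefl i)%g) (i := i).
rewrite -mulgA sreflK mulg1 => -> //; last exact: mul_srefl_pos; last first.
  by apply: weyl_mul wx' _; exact: weyl_srefl.
rewrite sgn_neg -?oppr_gt0 //.
by rewrite addrAC addNr add0r.
Qed.

Lemma lasc_lmul i x : weyl x.2 -> ~ lasc i x -> lasc i (lmul i x).
Proof.
move=> wx; have rx : root ((x.2^-1)%g (sroot i)) by apply: root_act (root_simple i); exact: weyl_inv.
rewrite /lasc /= invgM srefl_inv aut_mulE srefl_root autN bracket_coact srefl_inv srefl_root.
rewrite bracketNr opprK => na.
rewrite -[X in (_, X)]opprK -[(- _, _)]/(aneg ((x.2^-1)%g (sroot i), - << x.1, sroot i >>)).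
exact/aposN.
Qed.

Lemma lmul_dir i x : wa_plus x ->
  (lasc i x /\ (bruhat_step x (lmul i x) /\ alength L (lmul i x) = alength L x + 1)) \/
  (~ lasc i x /\ (bruhat_step (lmul i x) x /\ alength L x = alength L (lmul i x) + 1)).
Proof.
move=> px; have [a|na] := pselect (lasc i x); [left|right]; split=> //; first exact: lasc_up.
have := lasc_up (lmul_plus i px) (lasc_lmul (proj2 px) na); rewrite lmulK.
by [].
Qed.

End Length.
End Affine.

(** * The lifting property *)

(** The order and its two families of involutions, left and right multiplications
    by simple reflections, enter this section only through the hypotheses. *)
Section Lifting.
Variables (T : Type) (ok : T -> Prop) (step : T -> T -> Prop) (len : T -> rat) (phi : T -> T).
Local Notation lt := (clos_trans T step).

Definition up x := step x (phi x) /\ len (phi x) = len x + 1.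
Definition down x := step (phi x) x /\ len x = len (phi x) + 1.

Hypothesis step_ok : forall x y, step x y -> ok x /\ ok y.
Hypothesis phiK : involutive phi.
Hypothesis phi_dir : forall x, ok x -> up x \/ down x.
Hypothesis phi_step : forall x y, step x y -> y = phi x \/ step (phi x) (phi y).

(** The two properties of a generating relation that make up the theorem are
    [longer] and [graded_pair]. *)
Definition longer x y := exists k : nat, len y = len x + k.+1%:R.
Definition not_cover x y := exists z, lt x z /\ lt z y.
Definition graded_pair x y := len y = len x + 1 \/ not_cover x y.

Lemma longer_trans x y z : longer x y -> longer y z -> longer x z.
Proof.
move=> [k e] [k' e']; exists (k + k').+1; rewrite e' e -addrA -natrD addnS addSn.
by [].
Qed.

(** Passing from (phi x, phi y) to (x, y) decreases the length of x by one and
    changes that of y by one. *)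
Lemma longer_up x y : step x y -> up x -> (step (phi x) (phi y) -> longer (phi x) (phi y)) ->
  longer x y.
Proof.
move=> sxy [_ ux]; case: (phi_step sxy) => [-> _|s /(_ s) [k e]].
  by exists 0%N; rewrite ux.
case: (phi_dir (proj2 (step_ok sxy))) => -[_ dy].
  by exists k; move: e; rewrite dy ux addrAC => /addIr.
by exists k.+2; rewrite dy e ux -[k.+3]addn2 natrD; ring.
Qed.

Lemma longer_down x y : step x y -> down y -> (step (phi x) (phi y) -> longer (phi x) (phi y)) ->
  longer x y.
Proof.
move=> sxy [_ dy]; case: (phi_step sxy) => [e _|s /(_ s) [k e]].
  by exists 0%N; rewrite dy e phiK.
case: (phi_dir (proj1 (step_ok sxy))) => -[_ dx].
  by exists k.+2; rewrite dy e dx -[k.+3]addn2 natrD; ring.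
by exists k; rewrite dy e dx addrAC.
Qed.

Hypothesis step_longer : forall x y, step x y -> longer x y.

Lemma lt_longer x y : lt x y -> longer x y.
Proof. by elim=> [u v /step_longer//|u v w _ H _ G]; exact: longer_trans H G. Qed.

Lemma lt_irr x : ~ lt x x.
Proof.
move=> /lt_longer [k] /eqP; rewrite -subr_eq0 opprD addrA subrr add0r oppr_eq0.
by rewrite pnatr_eq0.
Qed.

Lemma lt_ok x y : lt x y -> ok x /\ ok y.
Proof. by elim=> [u v /step_ok//|u v w _ [H _] _ [_ G]]. Qed.

Local Notation le x y := (x = y \/ lt x y).

Lemma eq_or_lt_trans x y z : le x y -> le y z -> le x z.
Proof.
move=> [-> //|xy] [<-|yz]; first by right.
by right; exact: t_trans xy yz.
Qed.

Definition upper x := if `[< up x >] then phi x else x.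
Definition lower x := if `[< up x >] then x else phi x.

Lemma up_phi x : up x -> ~ up (phi x).
Proof.
move=> [s _] [s' _]; rewrite phiK in s'; apply: (@lt_irr x).
by apply: t_trans (t_step _ _ _ _ s) (t_step _ _ _ _ s').
Qed.
Lemma down_up x : down x -> ~ up x.
Proof.
move=> [s _] [s' _]; apply: (@lt_irr x).
by apply: t_trans (t_step _ _ _ _ s') (t_step _ _ _ _ s).
Qed.

Lemma pair_bounds x : ok x ->
  [/\ le (lower x) x, le (lower x) (phi x), le x (upper x) & le (phi x) (upper x)].
Proof.
move=> /phi_dir [u|d]; rewrite /lower /upper.
  by rewrite asboolT //; split; auto; right; apply: t_step; case: u.
by rewrite asboolF; [split; auto; right; apply: t_step; case: d|exact: down_up].
Qed.

Lemma lower_phi x : ok x -> lower (phi x) = lower x /\ upper (phi x) = upper x.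
Proof.
move=> /phi_dir [u|d]; rewrite /lower /upper.
  by rewrite asboolF ?asboolT ?phiK //; exact: up_phi.
rewrite asboolT ?asboolF ?phiK //; first exact: down_up.
by case: d => d1 d2; split; rewrite phiK.
Qed.

(** The lifting property of Bruhat orders. For a generating relation x < y other
    than y = phi x, also phi x < phi y, and one of these two relations bounds the
    lower elements of the two pairs, one of them the upper elements. *)
Lemma lift_lt x y : lt x y -> le (lower x) (lower y) /\ le (upper x) (upper y).
Proof.
elim=> [u v s|u v w _ [H1 H2] _ [G1 G2]]; last by split; apply: eq_or_lt_trans; eassumption.
have [ou ov] := step_ok s.
case: (phi_step s) => [->|s'].
  by have [-> ->] := lower_phi ou; auto.
have [a1 a2 a3 a4] := pair_bounds ou; have [b1 b2 b3 b4] := pair_bounds ov.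
have l1 : le u v by right; apply: t_step.
have l2 : le (phi u) (phi v) by right; apply: t_step.
split.
  rewrite [lower v]/lower; case: ifP => _; [exact: eq_or_lt_trans a1 l1|exact: eq_or_lt_trans a2 l2].
rewrite [upper u]/upper; case: ifP => _; [exact: eq_or_lt_trans l2 b4|exact: eq_or_lt_trans l1 b3].
Qed.

(** If phi y < y, then phi x is an intermediate element. Otherwise an element z
    between phi x and phi y is replaced by the lower element of its pair; this one
    can only be y if z = y, and then phi x is intermediate. *)
Lemma cover_up x y : step x y -> up x -> (step (phi x) (phi y) -> graded_pair (phi x) (phi y)) ->
  graded_pair x y.
Proof.
move=> sxy ux; have [ox oy] := step_ok sxy.
have lt_xphi : lt x (phi x) by apply: t_step; case: ux.
case: (phi_step sxy) => [-> _|s /(_ s) H]; first by left; case: ux.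
case: (phi_dir oy) => [uy|dy]; last first.
  right; exists (phi x); split=> //; apply: t_trans (t_step _ _ _ _ s) _.
  by apply: t_step; case: dy.
have lt_yphi : lt y (phi y) by apply: t_step; case: uy.
case: H => [e|[z [xz zy]]].
  by left; move: e; rewrite (proj2 ux) (proj2 uy) addrAC => /addIr.
have lowx : lower x = x by rewrite /lower asboolT.
have lowy : lower y = y by rewrite /lower asboolT.
have [_ oz] := lt_ok xz.
have [l1 _] := lift_lt xz; have [l2 _] := lift_lt zy.
rewrite (proj1 (lower_phi ox)) lowx in l1; rewrite (proj1 (lower_phi oy)) lowy in l2.
have zcase : z = lower z \/ z = phi (lower z).
  by rewrite /lower; case: ifP => _; [left | right; rewrite phiK].
right; case: l1 => [e1|l1].
  case: zcase; rewrite -e1 => ez; rewrite ez in xz; last by case: (lt_irr xz).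
  by case: (lt_irr (t_trans _ _ _ _ _ lt_xphi xz)).
case: l2 => [e2|l2]; last by exists (lower z).
case: zcase; rewrite e2 => ez; rewrite ez in xz zy; last by case: (lt_irr zy).
by exists (phi x).
Qed.

(** The mirror image of [cover_up], with upper elements. *)
Lemma cover_down x y : step x y -> down y -> (step (phi x) (phi y) -> graded_pair (phi x) (phi y)) ->
  graded_pair x y.
Proof.
move=> sxy dy; have [ox oy] := step_ok sxy.
have lt_yphi : lt (phi y) y by apply: t_step; case: dy.
case: (phi_step sxy) => [e _|s /(_ s) H].
  by left; case: dy => _ ->; rewrite e phiK.
case: (phi_dir ox) => [ux|dx].
  right; exists (phi y); split=> //; apply: t_trans (t_step _ _ _ _ s).
  by apply: t_step; case: ux.
have lt_xphi : lt (phi x) x by apply: t_step; case: dx.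
case: H => [e|[z [xz zy]]].
  by left; rewrite (proj2 dy) (proj2 dx) e.
have upx : upper x = x by rewrite /upper asboolF //; exact: down_up.
have upy : upper y = y by rewrite /upper asboolF //; exact: down_up.
have [_ l1] := lift_lt xz; have [_ l2] := lift_lt zy.
rewrite (proj2 (lower_phi ox)) upx in l1; rewrite (proj2 (lower_phi oy)) upy in l2.
have zcase : z = upper z \/ z = phi (upper z).
  by rewrite /upper; case: ifP => _; [right; rewrite phiK | left].
right; case: l2 => [e1|l2].
  case: zcase; rewrite e1 => ez; rewrite ez in zy; last by case: (lt_irr zy).
  by case: (lt_irr (t_trans _ _ _ _ _ lt_yphi zy)).
case: l1 => [e2|l1]; last by exists (upper z).
case: zcase; rewrite -e2 => ez; rewrite ez in xz zy; last by case: (lt_irr xz).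
by exists (phi y).
Qed.

End Lifting.

(** * Reduction to a dominant coweight *)

Section Reduction.
Variable D : root_datum.
Local Notation I := (idx D).
Local Notation X := (wt D).
Local Notation Y := (cowt D).
Local Notation WA := (Y * aut X)%type.
Local Notation aff := (X * int)%type.
Implicit Types (u b : X) (l m : Y) (w v g : aut X) (i j k : I) (x y z : WA) (a c : aff).

(** For y in W these are the inversions; their number decreases when y is replaced
    by y s_i < y. *)
Definition neg_fin y : set X := [set b | pos_root b /\ pos_aroot (aneg (wa_act y (b, 0)))]%classic.

Lemma finite_neg_fin y : wa_plus y -> finite_set (neg_fin y).
Proof.
move=> [ty wy]; have wy' := weyl_inv wy.
apply: (@sub_finite_set _ _ (neg_pairing (coact (y.2^-1)%g y.1) `|` inversions y.2)%classic).
  move=> b [pb [_ /=]]; rewrite add0r => H.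
  have E : << coact (y.2^-1)%g y.1, b >> = << y.1, y.2 b >> by rewrite bracket_coact invgK.
  case: H => [lt0|[_ nb]]; [left|right]; split=> //=.
  by rewrite E -oppr_gt0.
rewrite finite_setU; split; last exact: finite_inversions.
by apply: tits_finite; apply: tits_act.
Qed.

(** Left ascents of x first, since right multiplications keep the coweight of x
    dominant. *)
Lemma reduce_steps (R : WA -> WA -> Prop) :
  (forall i x y, bruhat_step x y -> lasc i x ->
     (bruhat_step (lmul i x) (lmul i y) -> R (lmul i x) (lmul i y)) -> R x y) ->
  (forall i x y, bruhat_step x y -> ~ rasc i y ->
     (bruhat_step (rmul i x) (rmul i y) -> R (rmul i x) (rmul i y)) -> R x y) ->
  (forall x y, bruhat_step x y -> dominant x.1 -> (forall i, rasc i y) -> R x y) ->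
  forall x y, bruhat_step x y -> R x y.
Proof.
move=> Hl Hr Hb.
have dom x y : bruhat_step x y -> dominant x.1 -> R x y.
  have [n] := ubnP #|` fset_set (neg_fin y) |; elim: n => // n IH in x y *; rewrite ltnS => yn sxy dx.
  have [all|/existsNP [i na]] := pselect (forall i, rasc i y); first exact: Hb.
  have [_ py _] := (iffLR (bruhat_stepP _ _) sxy).
  apply: (Hr i) => // s; apply: IH => //; apply: leq_trans yn.
  have act b : wa_act (rmul i y) (b, 0) = wa_act y (srefl i b, 0).
    by rewrite rmulE wa_act_mul simple_arefl_act.
  have yi : pos_aroot (aneg (wa_act y (sroot i, 0))).
    by apply/aposN => //; apply: wa_act_root; [case: py | exact: root_simple].
  have ne b : neg_fin (rmul i y) b -> pos_root b /\ b <> sroot i.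
    move=> [pb]; rewrite act => nb; split=> // e; move: nb.
    rewrite e srefl_root -[(- _, 0)]/(- sroot i, 0) -oppr0 -[(- _, _)]/(aneg (sroot i, 0)).
    by rewrite wa_act_neg anegK => /aroot_anti /(_ yi).
  apply: (proj2 (srefl_remove_card (finite_neg_fin py) _ ne _)).
    by split=> //; exact: pos_simple.
  move=> b nb; have [pb bi] := ne b nb; case: nb => _; rewrite act => nb.
  by split=> //; exact: srefl_pos.
move=> x y; have [n] := ubnP #|` fset_set (neg_pairing x.1) |.
elim: n => // n IH in x y *; rewrite ltnS => xn sxy.
have [all|/existsNP [i]] := pselect (dominant x.1); first exact: dom.
move=> /negP; rewrite -ltNge => lt0.
have [px _ _] := (iffLR (bruhat_stepP _ _) sxy); have [tx wx] := px.
apply: (Hl i) => // [|s].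
  split=> /=; last by left; rewrite oppr_gt0.
  by apply: root_act (root_simple i); exact: weyl_inv.
apply: IH => //; apply: leq_trans xn.
by apply: (proj2 (neg_pairing_card _ _)) => //; exact: tits_finite.
Qed.

(** Write y = pi^l w = w pi^mu. No right descent at alpha_i means that
    <mu, alpha_i> is positive, or zero with w(alpha_i) positive. A positive root
    orthogonal to mu is a combination of simple roots orthogonal to mu. *)
Lemma rasc_dominant y : wa_plus y -> (forall i, rasc i y) ->
  [/\ dominant (coact (y.2^-1)%g y.1), y.1 = coact y.2 (coact (y.2^-1)%g y.1) &
    forall b, pos_root b -> << coact (y.2^-1)%g y.1, b >> = 0 -> pos_root (y.2 b)].
Proof.
move=> [ty wy] H; set m := coact _ _.
have mE b : << m, b >> = << y.1, y.2 b >> by rewrite /m bracket_coact invgK.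
have dm : dominant m.
  move=> i; rewrite mE; have [_ /=] := H i; rewrite add0r.
  by case=> [/ltW|[->]].
split=> //; first by rewrite coactVK.
move=> b pb e; have [c c0 eb] := pos_nnX pb.
apply: nnX_pos; last by apply: root_act (pos_root_root pb).
have eb' : y.2 b = \sum_i c i *: y.2 (sroot i).
  by rewrite eb aut_sum; apply: eq_bigr => i _; rewrite autZ.
rewrite eb'; apply: (big_ind (nncomb (@sroot D))) => [|u u'|i _].
- by exists (fun=> 0) => //; rewrite big1 // => i _; rewrite scale0r.
- exact: nncombD.
have e0 : \sum_i c i * << m, sroot i >> = 0.
  rewrite -[RHS]e eb bracket_sumr; apply: eq_bigr => j _; exact/esym/bracketZr.
have /eqP : c i * << m, sroot i >> = 0.
  have nn j : true -> 0 <= c j * << m, sroot j >> by move=> _; rewrite mulr_ge0 //; exact: dm.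
  by have /eqP := e0; rewrite psumr_eq0 // => /allP /(_ i); rewrite mem_index_enum => /(_ isT) /eqP.
rewrite mulf_eq0 => /orP[/eqP ->|/eqP mi].
  by rewrite scale0r; exists (fun=> 0) => //; rewrite big1 // => j _; rewrite scale0r.
apply: nncombZ => //; apply: pos_nnX; have [_ /=] := H i; rewrite add0r -mE mi.
by case=> [|[]].
Qed.

(** * Chains of length three *)

Local Notation lt := (clos_trans WA (@bruhat_step D)).
Local Notation not_cover := (not_cover (@bruhat_step D)).

(** The chain y > y s_c > y s_c s_b > y s_b, by s_b = s_c s_b s_(c') with
    c' = - s_b(c). *)
Lemma chain_outer y (b c : aff) : wa_plus y -> pos_aroot b -> pos_aroot c ->
  pos_aroot (aneg (wa_act y c)) ->
  pos_aroot (aneg (wa_act (arefl b) c)) ->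
  pos_aroot (aneg (wa_act y (wa_act (arefl c) b))) ->
  not_cover (wa_mul y (arefl b)) y.
Proof.
move=> py pb pc yc c' ycb; have rb := pos_aroot_root pb; have rc := pos_aroot_root pc.
have s1 := step_down py pc yc; have [p1 _ _] := (iffLR (bruhat_stepP _ _) s1).
set z1 := wa_mul y (arefl c) in s1 p1.
have s2 : bruhat_step (wa_mul z1 (arefl b)) z1 by apply: step_down => //; rewrite wa_act_mul.
have [p2 _ _] := (iffLR (bruhat_stepP _ _) s2); set z2 := wa_mul z1 (arefl b) in s2 p2.
have rbc : root (wa_act (arefl b) c).1 by apply: wa_act_root rc; exact: weyl_root_refl.
have z2E : z2 = wa_mul (wa_mul y (arefl b)) (arefl (wa_act (arefl b) c)).
  rewrite /z2 /z1 !wa_mulA; congr (wa_mul y _).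
  rewrite (@arefl_conj D (arefl b)) //; last exact: weyl_root_refl.
  by rewrite arefl_actK.
have xE : wa_mul y (arefl b) = wa_mul z2 (arefl (aneg (wa_act (arefl b) c))).
  by rewrite arefl_neg // z2E areflK.
exists z2; split.
  apply: t_step; rewrite xE; apply: step_down => //.
  have -> : wa_act z2 (aneg (wa_act (arefl b) c)) = wa_act y c.
    by rewrite wa_act_neg /z2 /z1 !wa_act_mul arefl_actK // arefl_self // wa_act_neg anegK.
  by [].
by apply: t_trans (t_step _ _ _ _ s2) (t_step _ _ _ _ s1).
Qed.

(** The chain y > y s_c > y s_c s_d > y s_b, by s_b = s_c s_d s_c with
    d = s_c(b). *)
Lemma chain_inner y (b c : aff) : wa_plus y -> root b.1 -> pos_aroot c ->
  pos_aroot (aneg (wa_act y c)) ->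
  pos_aroot (aneg (wa_act y b)) ->
  pos_aroot (wa_act (arefl c) b) ->
  pos_aroot (wa_act y (wa_act (arefl b) c)) ->
  not_cover (wa_mul y (arefl b)) y.
Proof.
move=> py rb pc yc yb pd yc'; have rc := pos_aroot_root pc.
have s1 := step_down py pc yc; have [p1 _ _] := (iffLR (bruhat_stepP _ _) s1).
set z1 := wa_mul y (arefl c) in s1 p1.
set d := wa_act (arefl c) b in pd *.
have s2 : bruhat_step (wa_mul z1 (arefl d)) z1.
  by apply: step_down => //; rewrite wa_act_mul arefl_actK.
have [p2 _ _] := (iffLR (bruhat_stepP _ _) s2); set z2 := wa_mul z1 (arefl d) in s2 p2.
have xE : wa_mul y (arefl b) = wa_mul z2 (arefl c) by rewrite /z2 /z1 arefl_refl.
exists z2; split.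
  apply: t_step; rewrite xE; apply: step_down => //.
  have -> : z2 = wa_mul (wa_mul y (arefl b)) (arefl c) by rewrite xE areflK.
  by rewrite wa_act_mul arefl_self // wa_act_neg anegK wa_act_mul.
by apply: t_trans (t_step _ _ _ _ s2) (t_step _ _ _ _ s1).
Qed.

End Reduction.

(** * The length difference in dominant position *)

(** Here y = v2 pi^mu and x = y s_b with b = - theta + m pi. The element v is the
    one of v2 and v2 s_theta that sends theta to a positive root, and n counts
    from the corresponding end of the segment from mu to s_theta(mu); the coweight
    v(mu - n theta^vee) of x is dominant. For a root t, [opp t] is the root
    t' = - s_theta(t), and t |-> t' is an involution of S. *)
Section Base.
Variable D : root_datum.
Local Notation I := (idx D).
Local Notation X := (wt D).
Local Notation Y := (cowt D).
Local Notation WA := (Y * aut X)%type.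
Local Notation aff := (X * int)%type.
Implicit Types (t : X).
Local Notation not_cover := (not_cover (@bruhat_step D)).

Variables (mu : Y) (v2 v : aut X) (theta : X) (m n : int).
Local Notation N := << mu, theta >>.
Local Notation p := (bracket mu).
Local Notation a := (bracket (coroot theta)).
Local Notation S := (inv_fset (root_refl theta)).
Local Notation J := (inv_fset v).
Local Notation y := ((coact v2 mu, v2) : WA).
Local Notation x := (wa_mul y (arefl (- theta, m))).
Local Notation opp t := (- root_refl theta t).

Hypothesis wv : weyl v.
Hypothesis dmu : dominant mu.
Hypothesis minv2 : forall t, pos_root t -> p t = 0 -> pos_root (v2 t).
Hypothesis pth : pos_root theta.
Hypothesis pvth : pos_root (v theta).
Hypothesis n0 : 0 < n.
Hypothesis nN : 2 * n <= N.
Hypothesis dnu : dominant (coact v (mu - n *: coroot theta)).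
Hypothesis cases : v2 = v /\ m = n \/ v2 = (v * root_refl theta)%g /\ m = N - n.

Let rth : root theta := pos_root_root pth.
Let wrth : weyl (root_refl theta) := weyl_root_refl rth.

Lemma weyl_v2 : weyl v2.
Proof. by case: cases => -[-> _] //; apply: weyl_mul. Qed.

Lemma wa_plus_y : wa_plus y.
Proof. split; last exact: weyl_v2. by exists v2, mu; split=> //; exact: weyl_v2. Qed.

Lemma nu_bracket t : << coact v (mu - n *: coroot theta), v t >> = p t - n * a t.
Proof. by rewrite bracket_invariant bracketBl bracketZl. Qed.

(* Dominance of the coweight of x, read on roots through v. *)
Lemma dom_pos t : pos_root (v t) -> n * a t <= p t.
Proof. by move=> /(dominant_pos dnu); rewrite nu_bracket subr_ge0. Qed.
Lemma dom_neg t : pos_root (- v t) -> p t <= n * a t.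
Proof. by move=> /(dominant_neg dnu); rewrite nu_bracket subr_le0. Qed.

Lemma xE : x = (coact v (mu - n *: coroot theta),
  if `[< v2 = v >] then (v * root_refl theta)%g else v).
Proof.
have e1 : coact v2 mu + coact v2 (m *: coroot (- theta)) = coact v (mu - n *: coroot theta).
  rewrite coroot_opp // scalerN coactN -coactB; case: cases => -[-> ->] //.
  rewrite coactM; congr (coact v _); rewrite coact_root_refl // bracketBl bracketZl coroot_root //.
  rewrite -addrA -opprD -scalerDl; congr (_ - _ *: _); ring.
rewrite /wa_mul /arefl /= e1 root_refl_opp //; congr (_, _).
case: ifP => [/asboolP -> //|/asboolP ne]; case: cases => -[e _]; first by case: ne.
by rewrite e -mulgA root_reflK // mulg1.
Qed.

Lemma opp_opp t : opp (opp t) = t.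
Proof. by rewrite autN root_reflKx // opprK. Qed.
Lemma oppE t : opp t = a t *: theta - t.
Proof. by rewrite root_reflE // opprB. Qed.
Lemma a_opp t : a (opp t) = a t.
Proof. by rewrite oppE bracketBr bracketZr coroot_root //; ring. Qed.
Lemma p_opp t : p (opp t) = a t * N - p t.
Proof. by rewrite oppE bracketBr bracketZr. Qed.

Lemma inS t : reflect (pos_root t /\ pos_root (opp t)) (t \in S).
Proof. exact: inv_fsetP. Qed.
Lemma opp_inS t : (opp t \in S) = (t \in S).
Proof. by apply/inS/inS => -[]; rewrite ?opp_opp. Qed.
Lemma inJ t : reflect (pos_root t /\ pos_root (- v t)) (t \in J).
Proof. exact: inv_fsetP. Qed.

Lemma v_opp t : v (opp t) = a t *: v theta - v t.
Proof. by rewrite oppE autB autZ. Qed.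

Lemma pos_comb (c d : int) (t u : X) : 0 <= c -> 0 <= d -> pos_root t -> pos_root u ->
  root (c *: t + d *: u) -> pos_root (c *: t + d *: u).
Proof.
move=> c0 d0 pt pu; apply: nnX_pos; apply: nncombD; apply: nncombZ => //; exact: pos_nnX.
Qed.

(** An inversion t of v has p_t <= n a_t. The minimality of v2 excludes p_t = 0: for
    v2 = v s_theta, a root t orthogonal to mu with a_t >= 0 would give
    v2(t) = v(t) - a_t v(theta), which is negative. As n < N, the root s_theta(t),
    of pairing p_t - a_t N < 0 with mu, is negative. *)
Lemma J_facts t : t \in J -> [/\ t \in S, 0 < p t, p t <= n * a t & opp t \notin J].
Proof.
case/inJ => pt nt; have rt := pos_root_root pt.
have le := dom_neg nt; have ge0 := dominant_pos dmu pt.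
have p0 : 0 < p t.
  rewrite lt0r ge0 andbT; apply/eqP => p0; have := minv2 pt p0.
  case: cases => -[-> _]; first by move=> /pos_anti; apply.
  have a0 : 0 <= a t by move: le; rewrite p0 pmulr_rge0.
  rewrite aut_mulE -[root_refl _ _]opprK autN => pv.
  apply: (pos_anti pv); rewrite opprK v_opp -scaleN1r.
  have -> : a t *: v theta + -1 *: v t = a t *: v theta + 1 *: (- v t).
    by rewrite scaleN1r scale1r.
  apply: pos_comb => //; rewrite scale1r -v_opp; apply: root_act => //.
  by apply: root_opp; apply: root_act.
have a1 : 0 < a t by nia.
have tS : t \in S.
  apply/inS; split=> //; apply/posN; first by apply: root_act.
  move=> /(dominant_pos dmu); rewrite -[root_refl _ _]opprK bracketNr p_opp.
  by have := nN; nia.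
split=> //; apply/negP => /inJ [_]; rewrite v_opp => nvo.
have pvo : pos_root (a t *: v theta + 1 *: (- v t)).
  apply: pos_comb => //; first exact: ltW.
  by rewrite scale1r -v_opp; apply: root_act => //; case/inS: tS => _ /pos_root_root.
by apply: (pos_anti pvo); rewrite scale1r.
Qed.

Lemma subJS : {subset J <= S}. Proof. by move=> t /J_facts []. Qed.

(** Thus l(v) + l(v s_theta) = l(s_theta). *)
Lemma in_J_vtheta t : (t \in inv_fset (v * root_refl theta)%g) = (t \in S) && (opp t \notin J).
Proof.
have wvr : weyl (v * root_refl theta)%g by apply: weyl_mul.
have vE u : v (opp u) = - (v * root_refl theta)%g u by rewrite aut_mulE autN.
apply/inv_fsetP/andP => // -[].
  move=> pt nt; have tS : t \in S.
    apply/inS; split=> //; apply/posN; first exact: root_act (pos_root_root pt).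
    move=> pr; have /subJS/inS [_] : root_refl theta t \in J by apply/inJ; rewrite -aut_mulE.
    by rewrite root_reflKx // => /(pos_anti pt).
  split=> //; apply/negP => /inJ [_]; rewrite vE opprK => q; exact: pos_anti q nt.
move=> /inS [pt po] /negP nJ; split=> //; rewrite -vE.
have ro : root (v (opp t)) by apply: root_act (pos_root_root po).
case: (root_sign ro) => // no; by case: nJ; apply/inJ.
Qed.

(** The contribution of t in S to the length difference, after the contribution
    2 (p_t - n a_t) of an inversion t of v has been shared equally with t'. It is
    p_t - 1 if t is an inversion of v, p_t' - 1 if t' is one, and n a_t - 1
    otherwise. *)
Definition defect t : int := n * a t - 1 + (if t \in J then p t - n * a t else 0)
  + (if opp t \in J then p (opp t) - n * a (opp t) else 0).

Lemma theta_notin_J : theta \notin J.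
Proof. by apply/negP => /inJ [_ /(pos_anti pvth)]. Qed.
Lemma opp_theta : opp theta = theta.
Proof. by rewrite root_refl_root // opprK. Qed.
Lemma theta_in_S : theta \in S.
Proof. by apply/inS; rewrite opp_theta. Qed.
Lemma defect_theta : defect theta = 2 * n - 1.
Proof.
rewrite /defect opp_theta (negPf theta_notin_J) coroot_root // !addr0 mulrC.
by [].
Qed.

Lemma coroot_pairing_gt0 t : t \in S -> 0 < a t.
Proof.
case/inS => pt po; rewrite ltNge; apply/negP => a0; apply: (pos_anti pt).
have : root (- t) by apply: root_opp; exact: pos_root_root.
have -> : - t = 1 *: opp t + (- a t) *: theta by rewrite oppE scale1r scaleNr addrAC subrr add0r.
by apply: pos_comb => //; rewrite oppr_ge0.
Qed.

Lemma defect_ge0 t : t \in S -> 0 <= defect t.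
Proof.
move=> tS; rewrite /defect.
have a0 := coroot_pairing_gt0 tS.
case: ifPn => [tJ|_].
  have [_ p0 _ /negPf ->] := J_facts tJ; lia.
case: ifPn => [oJ|_]; last by nia.
by have [_ p0 _ _] := J_facts oJ; move: p0; rewrite a_opp; lia.
Qed.

Section Length.
Variable L : I -> wtQ D.
Hypothesis hL : fundamental_weights L.

Lemma fin_length_y : fin_length y = - \sum_(t <- inv_fset v2) 1.
Proof.
rewrite /fin_length /= sum_inv_inv; last exact: weyl_v2.
rewrite -sumrN; apply: eq_big_seq => t /inv_fsetP -/(_ weyl_v2) [pt nt].
rewrite bracketNr bracket_invariant; apply: sgn_neg; rewrite oppr_lt0 lt0r.
rewrite dominant_pos // andbT; apply/eqP => /(minv2 pt) pv; exact: pos_anti pv nt.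
Qed.

Lemma fin_length_x : fin_length x = \sum_(t <- inv_fset x.2) 1.
Proof.
have wx : weyl x.2 by apply: weyl_mul weyl_v2 _; apply: weyl_root_refl; exact: root_opp.
rewrite /fin_length sum_inv_inv //; apply: eq_big_seq => t /inv_fsetP -/(_ wx) [pt nt].
by apply: sgn_pos; apply: dominant_pos nt; rewrite xE.
Qed.

Lemma length_sum : \sum_(t <- inv_fset v2) 1 + \sum_(t <- inv_fset x.2) 1 = \sum_(t <- S) (1 : int).
Proof.
have E : \sum_(t <- J) 1 + \sum_(t <- inv_fset (v * root_refl theta)%g) 1 = \sum_(t <- S) (1 : int).
  have sub : {subset inv_fset (v * root_refl theta)%g <= S}.
    by move=> t; rewrite in_J_vtheta => /andP[].
  have E1 : \sum_(t <- J) (1 : int) = \sum_(t <- S) (if opp t \in J then 1 else 0).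
    by rewrite (sum_subfset _ subJS) big_mkcond /= (sum_inv_refl _ rth).
  have E2 : \sum_(t <- inv_fset (v * root_refl theta)%g) (1 : int)
      = \sum_(t <- S) (if opp t \in J then 0 else 1).
    rewrite (sum_subfset _ sub) big_mkcond; apply: eq_big_seq => t tS /=.
    by rewrite in_J_vtheta tS /=; case: (opp t \in J).
  by rewrite E1 E2 -big_split; apply: eq_bigr => t _ /=; case: ifP.
rewrite xE /=; case: ifPn => /asboolP e; first by rewrite e.
by case: cases => -[e' _]; [case: e | rewrite e' addrC].
Qed.

(** All the signs in the length are -1 for y and +1 for x, so that the difference is
    2 ht(mu) - 2 ht(lambda) - l(v) - l(v s_theta), with lambda the coweight of x. *)
Lemma alength_defect : alength L y = alength L x + (\sum_(t <- S) defect t)%:~R.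
Proof.
have wx : weyl x.2 by apply: weyl_mul weyl_v2 _; apply: weyl_root_refl; exact: root_opp.
have dy : dom_repr y.1 = mu by apply: dom_reprE => //; exact: weyl_v2.
have dx : dom_repr x.1 = coact v (mu - n *: coroot theta).
  by rewrite xE /= -[LHS]/(dom_repr _) -[X in dom_repr X]coact1 dom_reprE //; exact: weyl_one.
rewrite !alengthE //=; last exact: weyl_v2.
rewrite fin_length_y fin_length_x -[coact v2 mu]/(y.1) dy -[_ + coact _ _]/(x.1) dx.
have H1 := ht_act hL (mu - n *: coroot theta) wv.
have H2 := ht_coroot hL rth.
have H3 := length_sum.
rewrite htB htZ in H1.
have H4 : \sum_(t <- J) << mu - n *: coroot theta, t >>
   = \sum_(t <- S) (if t \in J then p t - n * a t else 0).
  rewrite (sum_subfset _ subJS) big_mkcond; apply: eq_bigr => t _.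
  by rewrite bracketBl bracketZl.
have H5 : \sum_(t <- S) defect t = n * \sum_(t <- S) a t - \sum_(t <- S) 1
   + 2 * \sum_(t <- J) << mu - n *: coroot theta, t >>.
  rewrite H4 /defect !big_split /= mulr_sumr sumrN.
  have -> : \sum_(t <- S) (if opp t \in J then p (opp t) - n * a (opp t) else 0)
     = \sum_(t <- S) (if t \in J then p t - n * a t else 0) by rewrite [RHS](sum_inv_refl _ rth).
  by ring.
rewrite H5.
set A := \sum_(t <- S) 1 in H3 *; set B := \sum_(t <- S) a t in H2 *.
set C := \sum_(t <- J) _ in H1 *; set E := \sum_(t <- inv_fset v2) 1 in H3 *.
set F := \sum_(t <- inv_fset x.2) 1 in H3 *.
rewrite -H3; move: H1 H2; rewrite !(rmorphD, rmorphN, rmorphM) /=.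
set hx := ht L (coact _ _); set hm := ht L mu; set ht := ht L (coroot _) => H1 H2.
have -> : hx = hm - n%:~R * ht - C%:~R by rewrite -H1; ring.
have -> : B%:~R = 2 * ht by rewrite H2.
by ring.
Qed.

End Length.

(** * Intermediate elements in dominant position *)

Let m0 : 0 < m. Proof. by case: cases => -[_ ->] //; have := nN; lia. Qed.
Let mN : m < N. Proof. by case: cases => -[_ ->]; have := nN; have := n0; lia. Qed.
Let rNth : root (- theta) := root_opp rth.

Lemma act_y t (k : int) : wa_act y (t, k) = (v2 t, k + p t).
Proof. by rewrite /wa_act /= bracket_invariant. Qed.

Lemma y_neg t (k : int) : root t -> k + p t < 0 \/ k + p t = 0 /\ pos_root (- v2 t) ->
  pos_aroot (aneg (wa_act y (t, k))).
Proof.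
move=> rt H; rewrite act_y; split; first by apply: root_opp; apply: root_act => //; exact: weyl_v2.
by case: H => [lt0|[e0 pt]]; [left; rewrite oppr_gt0 | right; rewrite /= e0 oppr0].
Qed.

Lemma x_lt_y : pos_aroot (aneg (wa_act y (- theta, m))).
Proof. by apply: y_neg => //; left; rewrite bracketNr subr_lt0. Qed.

(** The finite part of s_c(b), for c = - t + k pi. *)
Definition theta_refl t : X := << coroot t, theta >> *: t - theta.
Local Notation q t := << coroot t, theta >>.

Lemma theta_reflE t : root t -> theta_refl t = - root_refl t theta.
Proof. by move=> rt; rewrite root_reflE // opprB. Qed.
Lemma root_theta_refl t : root t -> root (theta_refl t).
Proof. by move=> rt; rewrite theta_reflE //; apply: root_opp; apply: root_act => //; exact: weyl_root_refl. Qed.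
Lemma p_theta_refl t : p (theta_refl t) = q t * p t - N.
Proof. by rewrite bracketBr bracketZr. Qed.
Lemma a_theta_refl t : a (theta_refl t) = q t * a t - 2.
Proof. by rewrite bracketBr bracketZr coroot_root. Qed.

Lemma act_c_b t (k : int) : root t ->
  wa_act (arefl (- t, k)) (- theta, m) = (theta_refl t, m - q t * k).
Proof.
move=> rt; rewrite arefl_act /=; last exact: root_opp.
rewrite coroot_opp // bracketNl bracketNr opprK; congr (_, _).
by rewrite scalerN opprK addrC.
Qed.
Lemma act_b_c t (k : int) :
  wa_act (arefl (- theta, m)) (- t, k) = (opp t, k - a t * m).
Proof.
rewrite arefl_act //= coroot_opp // bracketNl bracketNr opprK; congr (_, _).
by rewrite scalerN opprK addrC oppE.
Qed.

(* [chain_outer] for c = - t + k pi; then c' = - t' + (a_t m - k) pi. *)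
Lemma outer_chain t (k : int) : root t -> 0 < k -> k < p t -> 0 < a t * m - k ->
  m - q t * k + p (theta_refl t) < 0 \/
    m - q t * k + p (theta_refl t) = 0 /\ pos_root (- v2 (theta_refl t)) ->
  not_cover x y.
Proof.
move=> rt k0 kp ka H; apply: (@chain_outer _ _ _ (- t, k)).
- exact: wa_plus_y.
- by split=> //; left.
- by split; [exact: root_opp | left].
- by apply: y_neg; [exact: root_opp | left; rewrite bracketNr subr_lt0].
- rewrite act_b_c /aneg /= opprK opprB; split; last by left.
  exact: root_act.
- by rewrite act_c_b //; apply: y_neg H; exact: root_theta_refl.
Qed.

(* [chain_inner] for c = - t + k pi. *)
Lemma inner_chain t (k : int) : root t -> 0 < k -> k < p t ->
  0 < m - q t * k \/ m - q t * k = 0 /\ pos_root (theta_refl t) ->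
  0 < k - a t * m + p (opp t) -> not_cover x y.
Proof.
move=> rt k0 kp H ko; have ro : root (opp t) by apply: root_opp; exact: root_act.
apply: (@chain_inner _ _ _ (- t, k)).
- exact: wa_plus_y.
- exact: rNth.
- by split; [exact: root_opp | left].
- by apply: y_neg; [exact: root_opp | left; rewrite bracketNr subr_lt0].
- exact: x_lt_y.
- by rewrite act_c_b //; split=> //; exact: root_theta_refl.
- rewrite act_b_c act_y; split; last by left.
  by apply: root_act => //; exact: weyl_v2.
Qed.

Lemma theta_refl_theta : theta_refl theta = theta.
Proof. by rewrite theta_reflE // root_refl_root // opprK. Qed.

(** For n > 1 the affine dihedral group of the reflections along theta suffices. *)
Lemma far_not_cover : 1 < n -> not_cover x y.
Proof.
move=> n1; have qth : q theta = 2 by exact: coroot_root.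
have := nN; case: cases => -[ev em] nN'.
  apply: (@inner_chain theta 1); rewrite ?theta_refl_theta ?opp_theta ?qth //; try lia.
    rewrite em; have [e|ne] := eqVneq n 2; [right|left]; [split=> //|]; lia.
apply: (@outer_chain theta (N - 1)); rewrite ?theta_refl_theta ?opp_theta ?qth //; try lia.
have [e|ne] := eqVneq n 2; [right|left]; last by lia.
split; first by lia.
by rewrite ev aut_mulE root_refl_root // autN opprK.
Qed.

Section Near.
Hypothesis n1 : n = 1.

(* From here on n = 1, so that 2 <= N and m = 1 or m = N - 1. *)
Lemma near_pos t : pos_root (v t) -> a t <= p t.
Proof. by move=> /dom_pos; rewrite n1 mul1r. Qed.

Lemma root_v t : root t -> root (v t). Proof. exact: root_act. Qed.

(** With k = 1 when m = 1 and k = p_t - 1 when m = N - 1, the obstruction to a chain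
    is the pairing of mu with q t - theta being too large. *)
Lemma half_step t : root t -> 1 < a t -> 1 < p t -> 1 < q t ->
  not_cover x y \/ q t <= p (theta_refl t).
Proof.
move=> rt a1 p1 q1; have rs := root_theta_refl rt.
have [le|lt] := lerP (q t) (p (theta_refl t)); [by right | left].
have ps := p_theta_refl t; have as' := a_theta_refl t.
case: cases => -[ev em]; rewrite ?n1 in em.
  apply: (@outer_chain t 1) => //; first by rewrite em; lia.
  rewrite em mulr1; have [e|ne] := eqVneq (p (theta_refl t)) (q t - 1); [right|left]; last by lia.
  split; first by lia.
  rewrite ev; case: (root_sign (root_v rs)) => // /near_pos.
  rewrite as' e => H; nia.
apply: (@inner_chain t (p t - 1)) => //; try lia.
  rewrite em; have [e|ne] := eqVneq (p (theta_refl t)) (q t - 1); [right|left]; last by nia.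
  split; first by nia.
  case: (root_sign rs) => // /(dominant_neg dmu); rewrite e; lia.
by rewrite em p_opp; nia.
Qed.

Lemma coroot_opp_refl t : root t -> coroot (opp t) = q t *: coroot theta - coroot t.
Proof.
move=> rt; rewrite coroot_opp; last exact: root_act.
by rewrite coroot_act // coact_root_refl // opprB.
Qed.

Lemma q_opp t : root t -> q (opp t) = q t.
Proof. by move=> rt; rewrite coroot_opp_refl // bracketBl bracketZl coroot_root //; ring. Qed.

(** Both t' and its coroot q theta^vee - t^vee are positive. *)
Lemma q_gt0 t : t \in S -> 0 < q t.
Proof.
case/inS => pt po; have rt := pos_root_root pt; rewrite ltNge; apply/negP => q0.
have : nncomb (@scoroot D) (- coroot t).
  have -> : - coroot t = coroot (opp t) + (- q t) *: coroot theta.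
    by rewrite coroot_opp_refl // scaleNr addrAC subrr add0r.
  apply: nncombD; first exact: coroot_pos.
  by apply: nncombZ; [rewrite oppr_ge0 | exact: coroot_pos].
move=> /(nnY_anti (coroot_pos pt)) e; have := coroot_root rt.
by rewrite e bracket0l.
Qed.

(** Now s = t - theta. For m = 1 the inner chain needs s > 0, and the outer chain
    p_s < 0, or p_s = 0 and v(s) < 0. If both fail, v(t) = v(s) + v(theta) is
    positive, hence p_t >= a_t; this allows t and t' to be exchanged, and
    t' - theta = (a_t - 2) theta - s is positive. For m = N - 1 the outer chain
    needs v(t' - theta) > 0, and otherwise works after the same exchange. *)
Lemma unit_step t : t \in S -> q t = 1 -> 1 < a t -> 1 < p t -> a t <= p (opp t) ->
  not_cover x y.
Proof.
move=> tS q1 a1 p1 ap; have /inS [pt po] := tS; have rt := pos_root_root pt.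
have ro := pos_root_root po.
have qo : q (opp t) = 1 by rewrite q_opp.
have rs := root_theta_refl rt.
have ps := p_theta_refl t; rewrite q1 mul1r in ps.
have sE : theta_refl t = t - theta by rewrite /theta_refl q1 scale1r.
have soE : theta_refl (opp t) = (a t - 2) *: theta + 1 *: (- theta_refl t).
  rewrite /theta_refl qo q1 !scale1r oppE scalerBl opprB.
  rewrite -[2]/(1 + 1) scalerDl scale1r opprD -!addrA; congr (_ + _).
  by rewrite addKr addrC.
have rso := root_theta_refl ro.
have vt : v t = 1 *: v (theta_refl t) + 1 *: v theta by rewrite !scale1r -autD sE subrK.
have rvt := root_v rt.
have a2 : 0 <= a t - 2 by lia.
case: cases => -[ev em]; rewrite n1 in em.
  case: (root_sign rs) => sgs.
    apply: (@inner_chain t 1) => //; rewrite em ?q1; first by right.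
    lia.
  have ps0 : p (theta_refl t) <= 0 := dominant_neg dmu sgs.
  have [lt0|ge0] := ltrP (p (theta_refl t)) 0.
    by apply: (@outer_chain t 1) => //; rewrite ?em ?q1; [lia | left; lia].
  have e0 : p (theta_refl t) = 0 by lia.
  case: (root_sign (root_v rs)) => pv; last first.
    by apply: (@outer_chain t 1) => //; rewrite ?em ?q1; [lia | right; rewrite ev; split=> //; lia].
  have pvt : pos_root (v t) by rewrite vt in rvt *; apply: pos_comb.
  have apt := near_pos pvt.
  apply: (@inner_chain (opp t) 1) => //; rewrite ?em ?qo; first by lia.
    by right; split=> //; rewrite soE in rso *; apply: pos_comb.
  by rewrite a_opp opp_opp; lia.
have v2N u : - v2 u = v (opp u) by rewrite ev aut_mulE autN.
have po' := p_opp t.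
have so : opp (theta_refl t) = theta_refl (opp t).
  rewrite soE oppE a_theta_refl q1 mul1r scale1r. by [].
have vso : v (theta_refl (opp t)) = (a t - 2) *: v theta - v (theta_refl t).
  by rewrite soE autD !autZ scale1r autN.
case: (root_sign (root_v rso)) => pv.
  apply: (@outer_chain t (p t - 1)) => //; rewrite ?em ?q1; [lia | lia | nia | right].
  by split; [rewrite ps; ring | rewrite v2N so].
have pvs : pos_root (v (theta_refl t)).
  have E : v (theta_refl t) = (a t - 2) *: v theta + 1 *: (- v (theta_refl (opp t))).
    by rewrite vso scale1r opprB addrCA subrr addr0.
  by have := root_v rs; rewrite E => rE; apply: pos_comb.
have pvt : pos_root (v t) by rewrite vt in rvt *; apply: pos_comb.
have apt := near_pos pvt.
apply: (@outer_chain (opp t) (p (opp t) - 1)) => //; rewrite ?em ?qo ?a_opp; [lia | lia | nia | right].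
split; first by rewrite p_theta_refl qo; ring.
by rewrite v2N -so opp_opp.
Qed.

(** Any norm with integral values would do; it makes the recursion of
    [pair_not_cover] terminate. *)
Definition wt_size (u : X) : nat := (\sum_k absz (v2r u ord0 k))%N.

Lemma wt_sizeZ (k : int) u : wt_size (k *: u) = (absz k * wt_size u)%N.
Proof.
rewrite /wt_size big_distrr; apply: eq_bigr => j _.
by rewrite linearZ mxE abszM.
Qed.
Lemma wt_size_eq0 u : wt_size u = 0%N -> u = 0.
Proof.
move=> /eqP; rewrite sum_nat_eq0 => /forallP H; rewrite -[u]v2rK.
have -> : v2r u = 0.
  by apply/rowP => k; rewrite mxE; apply/eqP; have := H k; rewrite /= absz_eq0.
exact: linear0.
Qed.

(* This is t' - t. *)
Definition gap t : X := a t *: theta - 2 *: t.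

Lemma gap_theta_refl t : gap (theta_refl t) = q t *: gap t.
Proof.
rewrite /gap a_theta_refl /theta_refl !scalerBr !scalerA scalerBl opprB [2 * q t]mulrC.
by rewrite addrA subrK.
Qed.

Lemma gap_neq0 t : root t -> gap t = 0 -> 1 < a t -> 1 < q t -> t = theta.
Proof.
move=> rt /eqP; rewrite subr_eq0 => /eqP e a1 q1.
have : << coroot t, a t *: theta >> = << coroot t, 2 *: t >> by rewrite e.
rewrite !bracketZr coroot_root // => aq.
have a2 : a t = 2 by nia.
move: e; rewrite a2 => e; have /int_scale0 H : 2 *: (theta - t) = 0 by rewrite scalerBr e subrr.
have [/eqP|ne] := eqVneq (theta - t) 0; first by rewrite subr_eq0 => /eqP.
by have := H ne.
Qed.

(** The recursion replaces t by s = q t - theta. Stuck at t and at t', it has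
    p_s >= q and p_s' >= q with q >= 2, so s and s' are positive. Its measure is
    the size of t' - t, which is multiplied by q and is bounded on S. *)
Lemma pair_not_cover t : t \in S -> t != theta -> 1 < a t -> 1 < p t -> 1 < p (opp t) ->
  a t <= p t \/ a t <= p (opp t) -> not_cover x y.
Proof.
pose B := (\sum_(t <- S) wt_size (gap t))%N.
have Bmax u : u \in S -> (wt_size (gap u) <= B)%N.
  by move=> uS; rewrite /B (big_rem u) //= leq_addr.
have [d] := ubnP (B - wt_size (gap t))%N; elim: d => // d IH in t *; rewrite ltnS => td.
move=> tS tth a1 p1 po1 apt; have /inS [pt po] := tS.
have rt := pos_root_root pt; have ro := pos_root_root po.
have q0 := q_gt0 tS; have qo := q_opp rt; have ao := a_opp t.
have oS : opp t \in S by rewrite opp_inS.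
have [q1|qn1] := eqVneq (q t) 1.
  case: apt => apt; last exact: (unit_step tS).
  by apply: (unit_step oS) => //; rewrite ?qo ?ao ?opp_opp.
have q2 : 1 < q t by lia.
case: (half_step rt a1 p1 q2) => // ps.
case: (@half_step (opp t) ro) => //; rewrite ?ao ?qo // => pso.
set s := theta_refl t in ps *.
have rs : root s := root_theta_refl rt.
have as' : a s = q t * a t - 2 by exact: a_theta_refl.
have oso : opp s = theta_refl (opp t).
  rewrite oppE as' /s /theta_refl qo oppE scalerBr scalerBl scalerA -[2]/(1 + 1) scalerDl scale1r.
  by rewrite opprB opprD -!addrA; congr (_ + _); rewrite addKr addrC.
have rso : root (opp s) by rewrite oso; exact: root_theta_refl.
have poss u : root u -> 0 < p u -> pos_root u.
  by move=> ru pu; case: (root_sign ru) => // /(dominant_neg dmu); lia.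
have sS : s \in S.
  by apply/inS; split; apply: poss => //; [lia | rewrite oso; lia].
have sth : s != theta.
  apply: contra tth => /eqP e; apply/eqP; apply: gap_neq0 => //.
  have : gap s = 0 by rewrite e /gap coroot_root // subrr.
  rewrite gap_theta_refl => H; have [//|ne] := eqVneq (gap t) 0.
  by have := int_scale0 H ne; lia.
have gt0 : (0 < wt_size (gap t))%N.
  rewrite lt0n; apply: contra tth => /eqP /wt_size_eq0 g0; apply/eqP; exact: gap_neq0.
apply: (IH s) => //; rewrite ?oso; try lia.
- have := Bmax s sS; rewrite /s gap_theta_refl wt_sizeZ.
  move: td gt0; set g := wt_size (gap t) => td gt0 gB.
  have : (2 * g <= absz (q t) * g)%N by rewrite leq_mul2r; lia.
  move: gB; set e := (absz (q t) * g)%N => gB ge.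
  by move: (B) (g) (e) td gt0 gB ge => B' g' e'; lia.
- case: (root_sign (root_v rs)) => [/near_pos|pv]; first by left.
  right; rewrite -oso -(a_opp s); apply: near_pos; rewrite v_opp.
  have := root_v rso; rewrite v_opp -[- v s]scale1r => H; apply: pos_comb => //.
  by rewrite as'; nia.
Qed.

End Near.

(** A contribution of t other than theta gives 2 <= p_t <= a_t if t is an inversion
    of v, and a_t >= 2 if neither t nor t' is one. Positivity of v(t), or of v(t'),
    gives p_t >= a_t, or p_t' >= a_t. *)
Lemma defect_not_cover : \sum_(t <- S) defect t != 1 -> not_cover x y.
Proof.
have [n1|nn1] := eqVneq n 1; last by move=> _; apply: far_not_cover; lia.
rewrite (big_rem theta) ?theta_in_S //= defect_theta n1 => ne.
have [[t [tr dt]]|nex] := pselect (exists t, t \in rem theta S /\ 0 < defect t); last first.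
  case/eqP: ne; rewrite big_seq big1 ?addr0 // => t tr.
  apply/eqP; rewrite eq_le; apply/andP; split.
    by rewrite leNgt; apply/negP => lt; apply: nex; exists t.
  by apply: defect_ge0; exact: mem_rem tr.
move: tr; rewrite mem_rem_uniq ?fset_uniq // inE => /andP[tth tS].
have /inS [pt po] := tS.
have rt := pos_root_root pt; have ro := pos_root_root po.
have pv u : root u -> pos_root u -> u \notin J -> a u <= p u.
  move=> ru pu uJ; apply: near_pos => //; case: (root_sign (root_v ru)) => // nv.
  by case/negP: uJ; apply/inJ.
have inJ_case u : u \in S -> u != theta -> u \in J -> 0 < p u - 1 -> not_cover x y.
  move=> uS uth uJ pu; have [_ _ le onJ] := J_facts uJ; rewrite n1 mul1r in le.
  have /inS [pu0 puo] := uS.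
  have := pv _ (pos_root_root puo) puo onJ; rewrite a_opp => le'.
  by apply: (pair_not_cover n1 uS) => //; [lia | lia | lia | right].
have oth : opp t != theta.
  by apply: contra tth => /eqP e; rewrite -[t]opp_opp e opp_theta.
move: dt; rewrite /defect n1 !mul1r a_opp.
have [tJ|tJ] := boolP (t \in J).
  have [_ _ _ /negPf ->] := J_facts tJ => dt; apply: (inJ_case t) => //; lia.
have [oJ|oJ] := boolP (opp t \in J) => dt.
  by apply: (inJ_case (opp t)); rewrite ?opp_inS //; lia.
have l1 := pv _ rt pt tJ; have := pv _ ro po oJ; rewrite a_opp => l2.
by apply: (pair_not_cover n1 tS) => //; [lia | lia | lia | left].
Qed.

End Base.

(** * The grading *)

Section Main.
Variable D : root_datum.
Local Notation I := (idx D).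
Local Notation X := (wt D).
Local Notation Y := (cowt D).
Local Notation WA := (Y * aut X)%type.
Implicit Types (i : I) (x y z : WA).
Variable L : I -> wtQ D.
Hypothesis hL : fundamental_weights L.

Local Notation len := (alength L).
Local Notation step := (@bruhat_step D).
Local Notation lt := (clos_trans WA step).

(** The finite part of the root of the step is negative: for a positive one, y would
    have a descent excluded by [rasc_dominant]. The case m = N is excluded by the dominance of the
    coweight of x. *)
Lemma base_step x y : step x y -> dominant x.1 -> (forall i, rasc i y) ->
  longer len x y /\ graded_pair step len x y.
Proof.
move=> /bruhat_stepP [px py [[b m] [pa pxa e]]] dx H.
have [dmu yE min] := rasc_dominant py H; have [ty wv2] := py; have [tx wx] := px.
set mu := coact _ _ in dmu yE min; set v2 := y.2 in wv2 yE min.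
have {}yE : y = (coact v2 mu, v2) by rewrite -yE /v2; case: (y).
have rb : root b := pos_aroot_root pa.
have xE : x = wa_mul y (arefl (b, m)) by rewrite e areflK.
have yn : pos_aroot (aneg (wa_act y (b, m))).
  by rewrite e wa_act_mul arefl_self // wa_act_neg anegK.
rewrite yE /wa_act /= bracket_invariant in yn; case: yn => _ /= yn.
have x1 : x.1 = coact v2 (mu + m *: coroot b).
  by rewrite xE yE /= coactD.
case: (root_sign rb) => sb.
  have m0 : 0 <= m by case: pa => _ /= [/ltW|[->]].
  have p0 := dominant_pos dmu sb.
  case: yn => [|[e0 nb]]; first by lia.
  have /(min b sb) pv : << mu, b >> = 0 by lia.
  by case: (pos_anti pv nb).
have m0 : 0 < m by case: pa => _ /= [//|[_ /pos_anti /(_ sb)]].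
have [th bE] : exists th, b = - th by exists (- b); rewrite opprK.
rewrite {}bE ?opprK in e xE x1 yn pa pxa sb rb *.
have rth : root th := pos_root_root sb.
rewrite autN opprK bracketNr in yn.
rewrite coroot_opp // scalerN in x1.
have rv2 : root (v2 th) by exact: root_act.
have pair k : << coact v2 (mu - k *: coroot th), v2 th >> = << mu, th >> - 2 * k.
  by rewrite bracket_invariant bracketBl bracketZl coroot_root // mulrC.
have mN : m < << mu, th >>.
  case: yn => [|[e0 pv]]; first by lia.
  have := dominant_pos dx pv; rewrite x1 pair; lia.
have wr := weyl_root_refl rth.
have [v [n [wv pvth n0 [nN dnu cs]]]] : exists v (n : int), [/\ weyl v, pos_root (v th), 0 < n &
    [/\ 2 * n <= << mu, th >>, dominant (coact v (mu - n *: coroot th)) &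
     v2 = v /\ m = n \/ v2 = (v * root_refl th)%g /\ m = << mu, th >> - n]].
  case: (root_sign rv2) => sv.
    exists v2, m; split=> //; split; [|by rewrite -x1|by left].
    by have := dominant_pos dx sv; rewrite x1 pair subr_ge0.
  have xE' : coact (v2 * root_refl th)%g (mu - (<< mu, th >> - m) *: coroot th) = x.1.
    rewrite x1 coactM coact_root_refl // bracketBl bracketZl coroot_root //.
    by rewrite -addrA -opprD -scalerDl; congr (coact v2 (_ - _ *: _)); ring.
  have sv' : pos_root ((v2 * root_refl th)%g th) by rewrite aut_mulE root_refl_root // autN.
  exists (v2 * root_refl th)%g, (<< mu, th >> - m); split=> //.
  - exact: weyl_mul.
  - by rewrite subr_gt0.
  split; [|by rewrite xE'|right; split; [by rewrite -mulgA root_reflK // mulg1|ring]].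
  have := dominant_pos dx sv'; rewrite -xE' bracket_invariant bracketBl bracketZl coroot_root //.
  by lia.
have alen := alength_defect wv dmu min sb pvth n0 nN dnu cs hL.
have nc := defect_not_cover wv dmu min sb pvth n0 nN dnu cs.
rewrite -yE -xE in alen nc.
set s := \sum_(t <- _) _ in alen nc.
have s1 : 1 <= s.
  rewrite /s (big_rem th) ?(theta_in_S sb) //= (defect_theta mu n wv sb pvth).
  have : 0 <= \sum_(t <- rem th (inv_fset (root_refl th))) defect mu v th n t.
    rewrite big_seq; apply: sumr_ge0 => t /mem_rem tS.
    exact: (defect_ge0 wv dmu min sb pvth n0 nN dnu cs).
  have : 1 <= 2 * n - 1 by lia.
  by move=> h1 h2; rewrite -[1]addr0; exact: lerD.
split.
  exists (absz (s - 1)); rewrite alen; congr (_ + _).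
  by rewrite -[RHS]mulrz_nat; congr (_%:~R); rewrite natz; lia.
have [s1'|ns] := eqVneq s 1; first by left; rewrite alen s1'.
by right; exact: nc.
Qed.

Lemma step_plus x y : step x y -> wa_plus x /\ wa_plus y.
Proof. by move=> /bruhat_stepP []. Qed.

Lemma rmul_updown i x : wa_plus x ->
  up step len (rmul i) x \/ down step len (rmul i) x.
Proof. by move=> px; case: (rmul_dir L i px) => -[_ ?]; [left|right]. Qed.
Lemma lmul_updown i x : wa_plus x ->
  up step len (lmul i) x \/ down step len (lmul i) x.
Proof. by move=> px; case: (lmul_dir L i px) => -[_ ?]; [left|right]. Qed.

Lemma lmul_up i x : wa_plus x -> lasc i x -> up step len (lmul i) x.
Proof. by move=> px ax; case: (lmul_dir L i px) => -[]. Qed.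
Lemma rmul_down i x : wa_plus x -> ~ rasc i x -> down step len (rmul i) x.
Proof. by move=> px ax; case: (rmul_dir L i px) => -[]. Qed.

Lemma step_longer x y : step x y -> longer len x y.
Proof.
move: x y; apply: reduce_steps => [i x y s a|i x y s a|x y s dx H].
- apply: (longer_up step_plus (lmul_updown i) (@step_lmul D i) s).
  by apply: lmul_up => //; case: (step_plus s).
- apply: (longer_down step_plus (@rmulK D i) (rmul_updown i) (@step_rmul D i) s).
  by apply: rmul_down => //; case: (step_plus s).
by case: (base_step s dx H).
Qed.

Lemma step_graded x y : step x y -> graded_pair step len x y.
Proof.
move: x y; apply: reduce_steps => [i x y s a|i x y s a|x y s dx H].
- apply: (cover_up step_plus (@lmulK D i) (lmul_updown i) (@step_lmul D i) step_longer s).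
  by apply: lmul_up => //; case: (step_plus s).
- apply: (cover_down step_plus (@rmulK D i) (rmul_updown i) (@step_rmul D i) step_longer s).
  by apply: rmul_down => //; case: (step_plus s).
by case: (base_step s dx H).
Qed.

Lemma bruhat_longer x y : bruhat_lt x y -> longer len x y.
Proof. exact: (lt_longer step_longer). Qed.

Lemma longer_lt x y : longer len x y -> len x < len y.
Proof. by move=> [k ->]; rewrite ltrDl ltr0n. Qed.

Lemma bruhat_le_len x y : bruhat_le x y -> len x <= len y.
Proof. by move=> [->//|/bruhat_longer/longer_lt/ltW]. Qed.

Lemma lengthS_covers x y : wa_plus x -> wa_plus y -> bruhat_le x y -> len y = len x + 1 -> covers y x.
Proof.
move=> px py le e; have nxy : x <> y by move=> exy; move: e; rewrite exy; lra.
split=> //; apply/seteqP; split=> [z [pz xz zy]|z [->|->]] /=; last first.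
- by split=> //; left.
- by split=> //; left.
case: xz => [->|/bruhat_longer [k ek]]; first by left.
case: zy => [->|/bruhat_longer [k' ek']]; first by right.
exfalso; move: e; rewrite ek' ek -addrA => /addrI /eqP.
by rewrite -natrD -[1]/(1%:R) eqr_nat; lia.
Qed.

Lemma bruhat_lt_plus x y : bruhat_lt x y -> wa_plus x /\ wa_plus y.
Proof. exact: (lt_ok step_plus). Qed.

Lemma covers_lengthS x y : covers y x -> len y = len x + 1.
Proof.
move=> [nxy E].
have lexy : bruhat_le x y.
  have : [set x; y]%classic y by right.
  by rewrite -E => -[].
have ltxy : bruhat_lt x y by case: lexy.
have no z : bruhat_lt x z -> bruhat_lt z y -> False.
  move=> xz zy; have : [set x; y]%classic z.
    by rewrite -E; split; [case: (bruhat_lt_plus xz) | right | right].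
  by case=> ez; rewrite ez in xz zy; [move: xz|move: zy] => /bruhat_longer/longer_lt; rewrite ltxx.
have sxy : step x y by case: ltxy no => // z w xz zy /(_ z xz zy).
case: (step_graded sxy) => // -[z [xz zy]]; by case: (no z).
Qed.

Lemma alength_grading : Zgrading len.
Proof.
split=> x y px py; split.
- by move=> lxy; split; [left; right | exact: longer_lt (bruhat_longer lxy)].
- move=> [[[->|//]|/bruhat_le_len le] lt]; first by rewrite ltxx in lt.
  by rewrite ltNge le in lt.
- move=> c; split; last exact: covers_lengthS.
  by case: c => _ E; have : [set x; y]%classic y by [right]; rewrite -E => -[].
- by move=> [le e]; exact: lengthS_covers.
Qed.

End Main.

Theorem theorem1 (D : root_datum) (L : idx D -> wtQ D)
    (hL : fundamental_weights L) :
  Zgrading (alength L) /\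
  (forall x y : cowt D * aut (wt D), wa_plus x -> wa_plus y -> bruhat_le x y ->
     covers y x <-> alength L y - alength L x = 1).
Proof.
split=> [|x y px py le]; first exact: alength_grading.
split=> [/(covers_lengthS hL) ->|e]; first by rewrite addrAC subrr add0r.
by apply: (lengthS_covers hL) => //; rewrite -e addrCA subrr addr0.
Qed.
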